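(* Let $(A,\rho,[\cdot,\cdot])$ be a skew algebroid on a smooth manifold $M$, let $(\Pi,\xi)$ be a Jacobi structure on it, and let $\lambda\in\Gamma(A^\star)$. Then, for all $\alpha,\beta\in\Gamma(A^\star)$, $$\sharp_{\Pi,\xi}\left([\alpha,\beta]^\lambda_{\Pi,\xi}\right)-\left[\sharp_{\Pi,\xi}(\alpha),\sharp_{\Pi,\xi}(\beta)\right]=\Pi(\alpha,\beta)\left(\xi-\sharp_{\Pi,\xi}(\lambda)\right).$$
   Context: A skew algebroid on $M$ is a triple $(A,\rho,[\cdot,\cdot])$ where $A\to M$ is a vector bundle, $\rho:A\to TM$ is a vector bundle morphism (the anchor), and $[\cdot,\cdot]:\Gamma(A)\times\Gamma(A)\to\Gamma(A)$ is a skew-symmetric $\mathbb{R}$-bilinear bracket with $[a,\varphi b]=\varphi[a,b]+(\rho(a)\cdot\varphi)b$ for $\varphi\in C^\infty(M)$, $a,b\in\Gamma(A)$. An $A$-vector field is a section of $A$, an $A$-bivector field is a section of $\wedge^2A$, $A^\star$ is the dual bundle. Lie derivative: $\mathcal{L}^\rho_a\varphi=\rho(a)\cdot\varphi$, $(\mathcal{L}^\rho_a\eta)(a_1,\dots,a_k)=\rho(a)\cdot\eta(a_1,\dots,a_k)-\sum_i\eta(a_1,\dots,[a,a_i],\dots,a_k)$ for $\eta\in\Gamma(\wedge^kA^\star)$, and $\langle\mathcal{L}^\rho_aP,\eta\rangle=\rho(a)\cdot\langle P,\eta\rangle-\langle P,\mathcal{L}^\rho_a\eta\rangle$ for multivector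 fields $P$. For a function $\varphi$, $d_\rho\varphi(a)=\rho(a)\cdot\varphi$. The Schouten–Nijenhuis bracket on $\Gamma(\wedge^\bullet A)$ is the unique $\mathbb{R}$-bilinear bracket with $[\varphi,\psi]=0$ for functions, $[a,P]=\mathcal{L}^\rho_aP$ for $a\in\Gamma(A)$, $[P,Q]=(-1)^{kl}[Q,P]$ and $[P,Q\wedge R]=[P,Q]\wedge R+(-1)^{(k+1)l}Q\wedge[P,R]$ for $P\in\Gamma(\wedge^kA)$, $Q\in\Gamma(\wedge^lA)$. Exterior products are normalised so that $(\xi\wedge\Pi)(\alpha,\beta,\gamma)=\alpha(\xi)\Pi(\beta,\gamma)+\beta(\xi)\Pi(\gamma,\alpha)+\gamma(\xi)\Pi(\alpha,\beta)$. A pair $(\Pi,\xi)$ of an $A$-bivector field and an $A$-vector field is a Jacobi structure if $[\Pi,\Pi]=2\xi\wedge\Pi$ and $[\xi,\Pi]=\mathcal{L}^\rho_\xi\Pi=0$. For an $A$-bivector field $\Pi$: $\sharp_\Pi:A^\star\to A$ is defined by $\beta(\sharp_\Pi(\alpha))=\Pi(\alpha,\beta)$, and the Koszul bracket on $\Gamma(A^\star)$ is $[\alpha,\beta]_\Pi=\mathcal{L}^\rho_{\sharp_\Pi(\alpha)}\beta-\mathcal{L}^\rho_{\sharp_\Pi(\beta)}\alpha-d_\rho(\Pi(\alpha,\beta))$. For a pair $(\Pi,\xi)$ and $\lambda\in\Gamma(A^\star)$: $\sharp_{\Pi,\xi}(\alpha)=\sharp_\Pi(\alpha)+\alpha(\xi)\xi$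 and $$[\alpha,\beta]^\lambda_{\Pi,\xi}=[\alpha,\beta]_\Pi+\alpha(\xi)(\mathcal{L}^\rho_\xi\beta-\beta)-\beta(\xi)(\mathcal{L}^\rho_\xi\alpha-\alpha)-\Pi(\alpha,\beta)\lambda.$$ *)

(* Defs.v *)
From HB Require Import structures.
From mathcomp Require Import all_boot all_order all_algebra.
From mathcomp Require Import all_classical all_reals all_analysis.

Set Implicit Arguments.
Unset Strict Implicit.
Unset Printing Implicit Defensive.

Import Order.TTheory GRing.Theory Num.Theory.
Import numFieldNormedType.Exports.
Local Open Scope classical_set_scope.
Local Open Scope ring_scope.

Section Euclidean.
Variables (R : realType) (n : nat).
Implicit Types (U : set 'rV[R]_n) (f : 'rV[R]_n -> R).

Fixpoint Ck (k : nat) U f : Prop :=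
  (forall x, U x -> {for x, continuous f}) /\
  if k is k'.+1 then
    forall i : 'I_n, (forall x, U x -> derivable f x (delta_mx 0 i)) /\
                     Ck k' U (fun x => 'D_(delta_mx 0 i) f x)
  else True.

Definition Cinfty U f := forall k, Ck k U f.

End Euclidean.

(* The values of [cmap] off [cdom], and of [cinv] off the image of [cdom],
   are irrelevant. *)
Record chart (R : realType) (n : nat) (T : topologicalType) := Chart {
  cdom : set T;
  cmap : T -> 'rV[R]_n;
  cinv : 'rV[R]_n -> T;
  cdom_open : open cdom;
  cimg_open : open (cmap @` cdom);
  cmapK : forall x, cdom x -> cinv (cmap x) = x;
  cmap_continuous : forall x, cdom x -> {for x, continuous cmap};
  cinv_continuous : forall y, (cmap @` cdom) y -> {for y, continuous cinv}
}.

(* The atlas need not be maximal. *)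
Record manifold (R : realType) (n : nat) := Manifold {
  mcarrier :> topologicalType;
  atlas : set (chart R n mcarrier);
  manifold_hausdorff : hausdorff_space mcarrier;
  manifold_second_countable : @second_countable mcarrier;
  atlas_cover : forall x, exists2 c, atlas c & cdom c x;
  atlas_compatible : forall c d, atlas c -> atlas d -> forall j : 'I_n,
    Cinfty (cmap c @` (cdom c `&` cdom d)) (fun y => cmap d (cinv c y) 0 j)
}.

Section Manifold.
Variables (R : realType) (n : nat) (M : manifold R n).
Implicit Types (U : set M) (f g : M -> R).

(* f is smooth on the open set U *)
Definition smooth_on U f : Prop := forall c, atlas c ->
  Cinfty (cmap c @` (U `&` cdom c)) (f \o cinv c).

Definition smooth f : Prop := smooth_on setT f.

(* A tangent vector at x is a derivation at x of the algebra of smooth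
   functions; it is carried by a map on all functions, of which only the values
   on smooth functions matter. *)
Definition tangent_at (x : M) (v : (M -> R) -> R) : Prop :=
  (forall (k : R) f g, smooth f -> smooth g ->
     v (fun y => k * f y + g y) = k * v f + v g) /\
  (forall f g, smooth f -> smooth g ->
     v (fun y => f y * g y) = f x * v g + v f * g x).

(* the coordinate vector of index i of the chart c, at the point x of cdom c *)
Definition coord_vect (c : chart R n M) (i : 'I_n) (x : M) (f : M -> R) : R :=
  'D_(delta_mx 0 i) (f \o cinv c) (cmap c x).

End Manifold.

Record local_frame (R : realType) (T : Type) (F : T -> vectType R) (r : nat) :=
  LocalFrame { fdom : set T; fsec :> forall x, r.-tuple (F x) }.

(* A smooth vector bundle of rank r: its fibres, together with local frames over
   an open cover whose transition matrices are smooth. *)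
Record vector_bundle (R : realType) (n : nat) (M : manifold R n) (r : nat) :=
  VectorBundle {
  fibre :> M -> vectType R;
  frames : set (local_frame fibre r);
  fdom_open : forall e, frames e -> open (fdom e);
  frame_basis : forall e, frames e -> forall x, fdom e x ->
    basis_of fullv (e x);
  frames_cover : forall x, exists2 e, frames e & fdom e x;
  frames_compatible : forall e f, frames e -> frames f -> forall i j : 'I_r,
    smooth_on (fdom e `&` fdom f) (fun x => coord (f x) j (tnth (e x) i))
}.

Section Alternating.
Variables (R : realType) (V : lmodType R).
Implicit Types (f g : seq V -> R) (s : seq V).

(* A k-linear alternating map on V is encoded by its values on all finite
   sequences, extended by 0 to the sequences of length other than k; the scalars
   are the case k = 0. *)
Definition alternating (k : nat) f : Prop :=
  [/\ forall s, size s <> k -> f s = 0,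
      forall s1 s2 (a : R) u v,
        f (s1 ++ (a *: u + v) :: s2) = a * f (s1 ++ u :: s2) + f (s1 ++ v :: s2)
    & forall s1 s2 s3 u, f (s1 ++ u :: s2 ++ u :: s3) = 0].

(* The shuffle product: for f of degree k and g of degree l, the sum over the
   (k,l)-shuffles of sign * f(first k arguments) * g(last l arguments). The
   recursion says that inserting v as first argument is an antiderivation, with
   sign (-1)^(degree of f). *)
Fixpoint wedge f g s : R :=
  if s is v :: t then
    wedge (fun u => f (v :: u)) g t
    + wedge (fun u => (-1) ^+ size u * f u) (fun u => g (v :: u)) t
  else f [::] * g [::].

End Alternating.

Section Pairing.
Variables (R : realType) (V : vectType R).

Definition dual : vectType R := 'Hom(V, R^o).

Definition dual_vec (r : nat) (e : r.-tuple V) (i : 'I_r) : dual :=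
  linfun (coord e i : V -> R^o).

(* The pairing of Lambda^k V and Lambda^k V^*, the former being identified with
   the alternating maps on V^*, for which a product of k covectors pairs with P
   as the value of P on them. It is computed in a basis of V; [enum I] lists the
   elements of I in increasing order. *)
Definition pairing (P : seq dual -> R) (eta : seq V -> R) : R :=
  let b := vbasis (fullv : {vspace V}) in
  \sum_(I : {set 'I_(\dim (fullv : {vspace V}))})
     P [seq dual_vec b i | i <- enum I] * eta [seq tnth b i | i <- enum I].

End Pairing.

Section Fields.
Variables (R : realType) (n : nat) (M : manifold R n) (r : nat).
Variable A : vector_bundle M r.

Definition vfield := forall x : M, A x.
Definition covfield := forall x : M, dual (A x).
Definition formfield := forall x : M, seq (A x) -> R.
Definition mvfield := forall x : M, seq (dual (A x)) -> R.

Definition smooth_vec (a : vfield) : Prop := forall e, frames e ->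
  forall i : 'I_r, smooth_on (fdom e) (fun x => coord (e x) i (a x)).

Definition smooth_cov (al : covfield) : Prop := forall e, frames e ->
  forall i : 'I_r, smooth_on (fdom e) (fun x => al x (tnth (e x) i)).

Definition smooth_form (k : nat) (eta : formfield) : Prop :=
  (forall x, alternating k (eta x)) /\
  forall e, frames e -> forall s : seq 'I_r,
    smooth_on (fdom e) (fun x => eta x [seq tnth (e x) i | i <- s]).

Definition smooth_mv (k : nat) (P : mvfield) : Prop :=
  (forall x, alternating k (P x)) /\
  forall e, frames e -> forall s : seq 'I_r,
    smooth_on (fdom e) (fun x => P x [seq dual_vec (e x) i | i <- s]).

Definition fun_mv (phi : M -> R) : mvfield :=
  fun x s => if s is [::] then phi x else 0.

Definition vec_mv (a : vfield) : mvfield :=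
  fun x s => if s is [:: al] then al (a x) else 0.

End Fields.

Arguments fun_mv {R n M r A} phi x s.
Arguments vec_mv {R n M r A} a x s.

(* Brackets are operations on arbitrary sections; only their values on smooth
   sections are constrained, and used. *)
Record skew_algebroid (R : realType) (n : nat) (M : manifold R n) (r : nat)
    (A : vector_bundle M r) := SkewAlgebroid {
  anchor : forall x : M, A x -> (M -> R) -> R;
  bracket : vfield A -> vfield A -> vfield A;
  anchor_tangent : forall x (v : A x), tangent_at x (anchor v);
  anchor_linear : forall x (k : R) (u v : A x) (phi : M -> R), smooth phi ->
    anchor (k *: u + v) phi = k * anchor u phi + anchor v phi;
  (* smoothness of rho : A -> TM, in a frame of A and a coordinate frame *)
  anchor_smooth : forall (e : local_frame A r) (c : chart R n M),
    frames e -> atlas c -> exists rho : 'I_r -> 'I_n -> M -> R,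
      (forall i j, smooth_on (fdom e `&` cdom c) (rho i j)) /\
      forall x, fdom e x -> cdom c x -> forall i phi, smooth phi ->
        anchor (tnth (e x) i) phi = \sum_j rho i j x * coord_vect c j x phi;
  bracket_smooth : forall a b : vfield A, smooth_vec a -> smooth_vec b ->
    smooth_vec (bracket a b);
  bracket_skew : forall a b : vfield A, smooth_vec a -> smooth_vec b ->
    forall x, bracket a b x = - bracket b a x;
  bracket_linearl : forall (k : R) (a a' b : vfield A),
    smooth_vec a -> smooth_vec a' -> smooth_vec b -> forall x,
    bracket (fun y => k *: a y + a' y) b x
      = k *: bracket a b x + bracket a' b x;
  bracket_linearr : forall (k : R) (a b b' : vfield A),
    smooth_vec a -> smooth_vec b -> smooth_vec b' -> forall x,
    bracket a (fun y => k *: b y + b' y) x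
      = k *: bracket a b x + bracket a b' x;
  bracket_leibniz : forall (a b : vfield A) (phi : M -> R),
    smooth_vec a -> smooth_vec b -> smooth phi -> forall x,
    bracket a (fun y => phi y *: b y) x
      = phi x *: bracket a b x + anchor (a x) phi *: b x
}.

Section Calculus.
Variables (R : realType) (n : nat) (M : manifold R n) (r : nat).
Variables (A : vector_bundle M r) (G : skew_algebroid A).
Implicit Types (a b xi : vfield A) (al be la : covfield A).
Implicit Types (eta theta : formfield A) (P Q Pi : mvfield A).

Definition lie_fun a (phi : M -> R) : M -> R :=
  fun x => anchor G (a x) phi.

(* theta is the Lie derivative along a of the k-form eta *)
Definition is_lie_form (k : nat) a eta theta : Prop :=
  smooth_form k theta /\
  forall b : 'I_k -> vfield A, (forall i, smooth_vec (b i)) -> forall x,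
    theta x [seq b j x | j <- enum 'I_k]
    = lie_fun a (fun y => eta y [seq b j y | j <- enum 'I_k]) x
      - \sum_(i < k) eta x [seq (if j == i then bracket G a (b i) else b j) x
                           | j <- enum 'I_k].

(* Q is the Lie derivative along a of the k-vector field P *)
Definition is_lie_mv (k : nat) a P Q : Prop :=
  smooth_mv k Q /\
  forall eta theta, smooth_form k eta -> is_lie_form k a eta theta -> forall x,
    pairing (Q x) (eta x)
    = lie_fun a (fun y => pairing (P y) (eta y)) x - pairing (P x) (theta x).

(* The properties characterizing the Schouten-Nijenhuis bracket. The degree
   (k + l).-1 is only wrong for k = l = 0, where the bracket vanishes. *)
Record is_schouten (S : mvfield A -> mvfield A -> mvfield A) : Prop :=
  IsSchouten {
  schouten_smooth : forall k l P Q, smooth_mv k P -> smooth_mv l Q ->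
    smooth_mv (k + l).-1 (S P Q);
  schouten_linearl : forall k l (c : R) P P' Q,
    smooth_mv k P -> smooth_mv k P' -> smooth_mv l Q -> forall x s,
    S (fun y t => c * P y t + P' y t) Q x s = c * S P Q x s + S P' Q x s;
  schouten_linearr : forall k l (c : R) P Q Q',
    smooth_mv k P -> smooth_mv l Q -> smooth_mv l Q' -> forall x s,
    S P (fun y t => c * Q y t + Q' y t) x s = c * S P Q x s + S P Q' x s;
  schouten_fun : forall phi psi : M -> R, smooth phi -> smooth psi ->
    forall x s, S (fun_mv phi) (fun_mv psi) x s = 0;
  schouten_vec : forall k a P, smooth_vec a -> smooth_mv k P ->
    is_lie_mv k a P (S (vec_mv a) P);
  schouten_sym : forall k l P Q, smooth_mv k P -> smooth_mv l Q ->
    forall x s, S P Q x s = (-1) ^+ (k * l) * S Q P x s;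
  schouten_wedge : forall k l m P Q (T : mvfield A),
    smooth_mv k P -> smooth_mv l Q -> smooth_mv m T -> forall x s,
    S P (fun y => wedge (Q y) (T y)) x s
      = wedge (S P Q x) (T x) s
        + (-1) ^+ (k.+1 * l) * wedge (Q x) (S P T x) s
}.

Definition jacobi_structure (S : mvfield A -> mvfield A -> mvfield A) Pi xi :
    Prop :=
  [/\ smooth_mv 2 Pi, smooth_vec xi,
      forall x s, S Pi Pi x s = 2 * wedge (vec_mv xi x) (Pi x) s
    & forall x s, S (vec_mv xi) Pi x s = 0].

Definition d_rho (phi : M -> R) : covfield A :=
  fun x => linfun (fun v : A x => anchor G v phi : R^o).

(* the Lie derivative of a section of the dual bundle, determined at x by its
   values on all smooth sections *)
Definition lie_cov a be : covfield A := fun x =>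
  xget 0 [set g : dual (A x) | forall b, smooth_vec b ->
    g (b x) = lie_fun a (fun y => be y (b y)) x - be x (bracket G a b x)].

Definition sharp Pi al : vfield A := fun x =>
  xget 0 [set v : A x | forall g : dual (A x), g v = Pi x [:: al x; g]].

Definition koszul Pi al be : covfield A := fun x =>
  lie_cov (sharp Pi al) be x - lie_cov (sharp Pi be) al x
  - d_rho (fun y => Pi y [:: al y; be y]) x.

Definition sharp2 Pi xi al : vfield A := fun x =>
  sharp Pi al x + al x (xi x) *: xi x.

Definition koszul2 Pi xi la al be : covfield A := fun x =>
  koszul Pi al be x
  + al x (xi x) *: (lie_cov xi be x - be x)
  - be x (xi x) *: (lie_cov xi al x - al x)
  - Pi x [:: al x; be x] *: la x.

End Calculus.

(* Main.v *)
Require Import Defs.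
From HB Require Import structures.
From mathcomp Require Import all_boot all_order all_algebra.
From mathcomp Require Import all_classical all_reals all_analysis.
From mathcomp Require Import ring lra.
Set Implicit Arguments.
Unset Strict Implicit.
Unset Printing Implicit Defensive.
Import Order.TTheory GRing.Theory Num.Theory.
Import numFieldNormedType.Exports.
Local Open Scope classical_set_scope.
Local Open Scope ring_scope.

(** For a bivector field P let #P al be the section with be(#P al) = P(al, be).
The whole statement is an equality between vectors at one point, so it is tested
against a smooth covector field ga. After the Leibniz rule has been applied to
[#al + al(xi) xi, #be + be(xi) xi], two facts remain.

- Invariance, L_xi Pi = 0, reads
    ga([xi, #al]) = rho(xi) Pi(al, ga) + al([xi, #ga])
  ([lie_bivectorE]); it disposes of every bracket with xi.
- The defect of # from being a morphism for the Koszul bracket is governed by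
  [Pi, Pi]:
    [Pi, Pi](al, be, ga) / 2 = ga(#[al, be]_Pi - [#al, #be])
      = sum over the cyclic permutations of (al, be, ga) of
        rho(#al) Pi(be, ga) - al([#be, #ga])
  ([schouten_bivectorE], stated in the polarised form [P, Q]). With
  [Pi, Pi] = 2 xi /\ Pi this gives
  al(xi) #be - be(xi) #al + Pi(al, be) xi; the first two terms cancel against
  the terms - al(xi) be and be(xi) al of the modified bracket, and the last one,
  together with the term in la, is the right-hand side.

The Schouten bracket is only known through its axioms, which fix it on vector
fields and through the product rule. Both formulas are linear and local in a
bivector argument, hence it is enough to check them on a /\ b, where they are
a computation ([bivector_ind]). This reduction multiplies the bivector field by
a cutoff function and expands it in a local frame, so it rests on the existence of smooth
functions equal to 1 near a point and supported in a prescribed neighbourhood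
([cutoff_exists]). Cutoffs also give the global sections which make the
pointwise definition of the Lie derivative of a covector field meaningful
([tensorial], [lie_covE]). *)

(** * Flat functions of one variable *)
Section FlatFunctions.
Variable R : realType.
Implicit Types t : R.

(** The factors t^-m make the family stable under differentiation, so that
    smoothness of exp(-1/t) becomes an induction on the order. *)
Definition flat (m : nat) (t : R) : R :=
  if 0 < t then t^-1 ^+ m * expR (- t^-1) else 0.

Lemma flat_le0 m t : t <= 0 -> flat m t = 0.
Proof. by move=> t0; rewrite /flat ltNge t0. Qed.

Lemma flat0_gt0 t : 0 < t -> 0 < flat 0 t.
Proof. by move=> t0; rewrite /flat t0 expr0 mul1r expR_gt0. Qed.

(** exp(1/t) dominates its Taylor term of order m + 1. For the next index this
    bounds the difference quotient at 0. *)
Lemma flat_bound m t : `|flat m t| <= m.+1`!%:R * `|t|.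
Proof.
rewrite /flat; case: ifPn => [t0|_]; last by rewrite normr0 mulr_ge0.
rewrite gtr0_norm ?mulr_gt0 ?exprn_gt0 ?invr_gt0 ?expR_gt0//.
rewrite (gtr0_norm t0) expRN ler_pdivrMr ?expR_gt0//.
have := @expR_ge1Dxn R t^-1 m (ltW _); rewrite invr_gt0 => /(_ t0) h.
apply: (@le_trans _ _ (m.+1`!%:R * t * (t^-1 ^+ m.+1 / m.+1`!%:R))).
  rewrite exprS le_eqVlt; apply/orP; left; apply/eqP; field.
  by rewrite ?pnatr_eq0 -?lt0n ?fact_gt0 lt0r_neq0.
rewrite ler_wpM2l ?mulr_ge0 ?(ltW t0)//.
by apply: le_trans h; rewrite lerDr.
Qed.

Lemma flat_derive m t :
  is_derive t 1 (flat m) (flat m.+2 t - m%:R * flat m.+1 t).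
Proof.
case: (ltgtP t 0) => t0.
- rewrite !flat_le0 ?(ltW t0)// mulr0 subr0.
  apply: (@near_eq_is_derive R R R (cst 0) (flat m)) => //.
  by near=> y; rewrite flat_le0//; apply: ltW; near: y; exact: lt_nbhsl.
- apply: (@near_eq_is_derive R R R (fun y : R => y^-1 ^+ m * expR (- y^-1) : R) (flat m)).
    by near=> y; rewrite /flat ifT//; near: y; exact: lt_nbhsr.
  rewrite /flat t0.
  have dV : is_derive t 1 (fun y : R => y^-1) (- t ^- 2).
    have := @is_deriveV R id t 1 1 (lt0r_neq0 t0) (is_derive_id _ _).
    by rewrite /GRing.scale/= mulr1.
  have dN : is_derive t 1 (fun y : R => - y^-1) (t ^- 2).
    by rewrite -[t ^- 2]opprK; exact: is_deriveN.
  have dE : is_derive t 1 (fun y : R => expR (- y^-1)) (expR (- t^-1) * t^-2).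
    exact: (@is_derive1_comp R expR (fun y : R => - y^-1)).
  have dX : is_derive t 1 (fun y : R => y^-1 ^+ m) (m%:R * t^-1 ^+ m.-1 * - t^-2).
    have -> : (fun y : R => y^-1 ^+ m) = (fun y : R => y^-1) ^+ m.
      by apply/funext => y; rewrite exprfctE.
    exact: is_deriveX.
  apply: is_derive_eq (is_deriveM dX dE) _.
  rewrite /GRing.scale/=.
  by case: (m) => [|k]; rewrite ?exprS; field; exact: lt0r_neq0.
- rewrite t0 !flat_le0// mulr0 subr0.
  have cv0 : h^-1 *: ((flat m \o shift 0) (h *: 1) - flat m 0) @[h --> 0^'] --> 0.
    apply/cvgr0Pnorm_le => e e0; near=> h.
    have h0 : h != 0 by near: h; exact: nbhs_dnbhs_neq.
    rewrite /= addr0 (@flat_le0 m 0)// subr0.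
    (* dividing by h raises the index, and the bound applies again *)
    have -> : h^-1 *: flat m (h *: 1) = flat m.+1 h.
      rewrite /GRing.scale/= mulr1 /flat; case: ifP => _; last by rewrite mulr0.
      by rewrite exprS mulrA.
    apply: le_trans (flat_bound _ _) _.
    rewrite mulrC -ler_pdivlMr ?ltr0n ?fact_gt0//; apply: ltW.
    by near: h; apply: dnbhs0_lt; rewrite divr_gt0// ltr0n fact_gt0.
  apply: DeriveDef; first by apply/cvg_ex; exists 0.
  exact: cvg_lim cv0.
Unshelve. all: by end_near. Qed.

End FlatFunctions.

(** * Functions of class C^k *)

(** A directional derivative is a derivative along a line, which reduces the
    chain rule for an outer function of one variable to dimension one. *)
Lemma derive_along (R : realType) (V : normedModType R) (f : V -> R) (x v : V)
    (d : R) :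
  is_derive x v f d <-> is_derive (0 : R) 1 (fun t : R => f (t *: v + x)) d.
Proof.
have e : (fun h => h^-1 *: ((f \o shift x) (h *: v) - f x)) =
  (fun h : R => h^-1 *: (((fun t : R => f (t *: v + x)) \o shift 0) (h *: 1)
                    - f (0 *: v + x))).
  by apply/funext => h /=; rewrite addr0 scale0r add0r [h *: 1]mulr1.
split=> -[c l].
  by apply: DeriveDef; rewrite /derivable /derive -e.
by apply: DeriveDef; rewrite /derivable /derive e.
Qed.

Lemma is_derive_comp_along (R : realType) (V : normedModType R) (f : V -> R)
    (h : R -> R) (x v : V) (a b : R) :
  is_derive (f x) 1 h a -> is_derive x v f b -> is_derive x v (h \o f) (a * b).
Proof.
move=> hh /derive_along hf; apply/derive_along.
apply: (@is_derive1_comp R h (fun t : R => f (t *: v + x))) => //.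
by rewrite scale0r add0r.
Qed.

Lemma continuous_eq_on (T S : topologicalType) (U : set T) (f g : T -> S) x :
  open U -> (forall y, U y -> f y = g y) -> U x ->
  {for x, continuous f} -> {for x, continuous g}.
Proof.
move=> oU fg Ux cf; have nU := open_nbhs_nbhs (conj oU Ux).
rewrite /prop_for /continuous_at -fg//; apply: cvg_trans cf.
by apply: near_eq_cvg; apply: filterS nU => y /fg.
Qed.

Section CkCalculus.
Variables (R : realType) (n : nat).
Implicit Types (U V : set 'rV[R]_n) (f g : 'rV[R]_n -> R).

Lemma Ck_cont k U f : Ck k U f -> forall x, U x -> {for x, continuous f}.
Proof. by case: k => [|k] []. Qed.

Lemma Ck_subset k U V f : V `<=` U -> Ck k U f -> Ck k V f.
Proof.
move=> VU; elim: k f => [|k IH] f [cf df]; split => //; try by move=> x /VU/cf.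
by move=> i; have [d1 d2] := df i; split; [move=> x /VU/d1 | exact: IH].
Qed.

Lemma Ck_local k U f : (forall x, U x -> Ck k [set x] f) -> Ck k U f.
Proof.
elim: k f => [|k IH] f h; split => //; try by move=> x /h /Ck_cont; apply.
move=> i; split=> [x /h[_ /(_ i)[+ _]]|]; first exact.
by apply: IH => x /h[_ /(_ i)[_ +]].
Qed.

Lemma Ck_eq k U f g : open U -> (forall x, U x -> f x = g x) ->
  Ck k U f -> Ck k U g.
Proof.
move=> oU; elim: k f g => [|k IH] f g fg [cf df].
  by split=> // x Ux; exact: (continuous_eq_on oU fg Ux (cf x Ux)).
split; first by move=> x Ux; exact: (continuous_eq_on oU fg Ux (cf x Ux)).
move=> i; have [d1 d2] := df i; split.
  move=> x Ux; have nU := open_nbhs_nbhs (conj oU Ux).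
  by apply: near_eq_derivable (d1 x Ux); apply: filterS nU => y /fg.
apply: IH d2 => x Ux; have nU := open_nbhs_nbhs (conj oU Ux).
by apply: near_eq_derive; apply: filterS nU => y /fg.
Qed.

Lemma CkS k U f : Ck k.+1 U f -> Ck k U f.
Proof.
elim: k f => [|k IH] f [cf df]; split=> //.
by move=> i; have [d1 d2] := df i; split => //; exact: IH.
Qed.

Lemma Ck_cst k U (a : R) : Ck k U (fun=> a).
Proof.
elim: k a => [|k IH] a; split=> //; try by move=> x _; apply: cst_continuous.
move=> i; split=> [x _|]; first exact: derivable_cst.
suff -> : (fun x : 'rV[R]_n => 'D_(delta_mx 0 i) (fun=> a) x) = (fun=> 0 : R) by exact: IH.
by apply: funext => x; exact: derive_cst.
Qed.

Lemma CkD k U f g : open U -> Ck k U f -> Ck k U g ->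
  Ck k U (fun x => f x + g x).
Proof.
move=> oU; elim: k f g => [|k IH] f g [cf df] [cg dg].
  by split=> // x Ux; exact: cvgD (cf x Ux) (cg x Ux).
split; first by move=> x Ux; exact: cvgD (cf x Ux) (cg x Ux).
move=> i; have [f1 f2] := df i; have [g1 g2] := dg i; split.
  by move=> x Ux; apply: (@derivableD R _ _ f g); [exact: f1|exact: g1].
apply: (Ck_eq oU _ (IH _ _ f2 g2)) => x Ux.
by rewrite (@deriveD R _ _ f g)//; [exact: f1|exact: g1].
Qed.

Lemma CkM k U f g : open U -> Ck k U f -> Ck k U g ->
  Ck k U (fun x => f x * g x).
Proof.
move=> oU; elim: k f g => [|k IH] f g Cf Cg; have [cf df] := Cf; have [cg dg] := Cg.
  by split=> // x Ux; exact: cvgM (cf x Ux) (cg x Ux).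
split; first by move=> x Ux; exact: cvgM (cf x Ux) (cg x Ux).
move=> i; have [f1 f2] := df i; have [g1 g2] := dg i; split.
  by move=> x Ux; apply: (@derivableM R _ f g); [exact: f1|exact: g1].
apply: (Ck_eq oU _ (CkD oU (IH _ _ (CkS Cf) g2) (IH _ _ (CkS Cg) f2))) => x Ux.
by rewrite (@deriveM R _ f g)//; [exact: f1|exact: g1].
Qed.

(** The only composition needed below has an outer function of one variable;
    its derivative involves the next two indices, whence the quantification over
    m inside the induction. *)
Lemma Ck_flat k m U f : open U -> Ck k U f -> Ck k U (fun x => flat m (f x)).
Proof.
move=> oU; elim: k m f => [|k IH] m f Cf; have [cf df] := Cf.
  split=> // x Ux; apply: continuous_comp; first exact: cf.
  by apply/differentiable_continuous/derivable1_diffP; case: (flat_derive m (f x)).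
split.
  move=> x Ux; apply: continuous_comp; first exact: cf.
  by apply/differentiable_continuous/derivable1_diffP; case: (flat_derive m (f x)).
move=> i; have [f1 f2] := df i.
have D x : U x -> is_derive x (delta_mx 0 i) (flat m \o f)
    ((flat m.+2 (f x) + - m%:R * flat m.+1 (f x)) * 'D_(delta_mx 0 i) f x).
  move=> Ux; rewrite mulNr; apply: is_derive_comp_along (flat_derive _ _) _.
  by apply: DeriveDef => //; exact: f1.
split; first by move=> x /D[].
apply: (Ck_eq oU (f := fun x => (flat m.+2 (f x) + - m%:R * flat m.+1 (f x))
   * 'D_(delta_mx 0 i) f x)) => [x /D[_ ->]//|].
have Cf' := CkS Cf.
by apply: CkM => //; apply: CkD => //; [exact: IH|apply: CkM => //; [exact: Ck_cst|exact: IH]].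
Qed.

End CkCalculus.

(** * Smooth functions and cutoffs on a manifold *)
Section SmoothFunctions.
Variables (R : realType) (n : nat) (M : manifold R n).
Implicit Types (U V : set M) (f g : M -> R).

Lemma chart_image_open (c : chart R n M) U :
  open U -> open (cmap c @` (U `&` cdom c)).
Proof.
move=> oU; rewrite openE => _ [x [Ux cx] <-]; rewrite /interior.
have im : (cmap c @` cdom c) (cmap c x) by exists x.
have n1 := open_nbhs_nbhs (conj (@cimg_open _ _ _ c) im).
have := cinv_continuous im; rewrite /prop_for /continuous_at (cmapK cx) => cc.
have n2 := cc _ (open_nbhs_nbhs (conj oU Ux)).
apply: filterS2 n1 n2 => _ [z cz <-] /=; rewrite cmapK// => Uz.
by exists z.
Qed.

Lemma smooth_on_subset U V f : V `<=` U -> smooth_on U f -> smooth_on V f.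
Proof.
move=> VU sf c ac k; apply: Ck_subset (sf c ac k).
by apply: image_subset => x [/VU].
Qed.

(** Smoothness depends only on germs. This is how functions that are glued from
    local formulas are shown to be smooth. *)
Lemma smooth_on_local U f :
  (forall x, U x -> exists V g, [/\ open V, V x, smooth_on V g &
     forall y, V y -> f y = g y]) -> smooth_on U f.
Proof.
move=> loc c ac k; apply: Ck_local => _ [x [Ux cx] <-].
have [V [g [oV Vx sg fg]]] := loc x Ux.
have o := @chart_image_open c _ oV.
apply: (@Ck_subset _ _ _ (cmap c @` (V `&` cdom c))).
  by move=> _ ->; exists x.
apply: (Ck_eq o _ (sg c ac k)) => _ [z [Vz cz] <-] /=.
by rewrite cmapK// fg.
Qed.

Lemma smooth_on_eq U f g : open U -> (forall x, U x -> f x = g x) ->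
  smooth_on U g -> smooth_on U f.
Proof. by move=> oU fg sg; apply: smooth_on_local => x Ux; exists U, g. Qed.

Lemma smooth_on_continuous U f x :
  open U -> smooth_on U f -> U x -> {for x, continuous f}.
Proof.
move=> oU sf Ux; have [c ac cx] := atlas_cover x.
have h : {for cmap c x, continuous (f \o cinv c)}.
  by apply: (Ck_cont (sf c ac 0%N)); exists x.
apply: (@continuous_eq_on _ _ (cdom c) (fun y => (f \o cinv c) (cmap c y))) => //.
- exact: cdom_open.
- by move=> y cy /=; rewrite cmapK.
- by apply: continuous_comp => //; exact: cmap_continuous.
Qed.

Lemma smooth_on_cst U (a : R) : smooth_on U (fun=> a).
Proof. by move=> c ac k; exact: Ck_cst. Qed.

Lemma smooth_onD U f g : open U -> smooth_on U f -> smooth_on U g ->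
  smooth_on U (fun x => f x + g x).
Proof.
move=> oU sf sg c ac k; exact: (CkD (@chart_image_open c _ oU) (sf c ac k) (sg c ac k)).
Qed.

Lemma smooth_onM U f g : open U -> smooth_on U f -> smooth_on U g ->
  smooth_on U (fun x => f x * g x).
Proof.
move=> oU sf sg c ac k; exact: (CkM (@chart_image_open c _ oU) (sf c ac k) (sg c ac k)).
Qed.

Lemma smooth_on_flat U m f : open U -> smooth_on U f ->
  smooth_on U (fun x => flat m (f x)).
Proof.
by move=> oU sf c ac k; exact: (Ck_flat m (@chart_image_open c _ oU) (sf c ac k)).
Qed.

Lemma smooth_onB U f g : open U -> smooth_on U f -> smooth_on U g ->
  smooth_on U (fun x => f x - g x).
Proof.
move=> oU sf sg; apply: (@smooth_on_eq _ _ (fun x => f x + -1 * g x)) => //.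
  by move=> x _; rewrite mulN1r.
by apply: smooth_onD => //; apply: smooth_onM => //; exact: smooth_on_cst.
Qed.

Lemma smooth_on_sum U (I : Type) (r : seq I) (P : pred I) (F : I -> M -> R) :
  open U -> (forall i, P i -> smooth_on U (F i)) ->
  smooth_on U (fun x => \sum_(i <- r | P i) F i x).
Proof.
move=> oU sF; elim: r => [|i r IH].
  apply: (@smooth_on_eq _ _ (fun=> 0)) => // [x _|]; first by rewrite big_nil.
  exact: smooth_on_cst.
case Pi: (P i).
  apply: (@smooth_on_eq _ _ (fun x => F i x + \sum_(i <- r | P i) F i x)) => //.
    by move=> x _; rewrite big_cons Pi.
  by apply: smooth_onD => //; exact: sF.
by apply: (smooth_on_eq oU _ IH) => x _; rewrite big_cons Pi.
Qed.

Lemma smooth_on_coord (c : chart R n M) j :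
  atlas c -> smooth_on (cdom c) (fun x => cmap c x 0 j).
Proof. by move=> ac d ad k; rewrite setIC; exact: atlas_compatible. Qed.

Lemma smooth_onT U f : smooth f -> smooth_on U f.
Proof. exact: smooth_on_subset. Qed.

Lemma smoothN f : smooth f -> smooth (fun y => - f y).
Proof.
move=> sf; have -> : (fun y => - f y) = (fun y => 0 - f y).
  by apply/funext => y; rewrite sub0r.
by apply: smooth_onB => //; [exact: openT | exact: smooth_on_cst].
Qed.

Lemma smoothM f g : smooth f -> smooth g -> smooth (fun y => f y * g y).
Proof. by move=> sf sg; apply: smooth_onM => //; exact: openT. Qed.

(** A closed K inside U, and not only vanishing off U, is what lets phi * f be
    smooth everywhere when f is smooth only on U. *)
Record cutoff (x : M) (U : set M) (phi : M -> R) : Prop := Cutoff {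
  cutoff_smooth : smooth phi;
  cutoff_one : exists V, [/\ open V, V x & forall y, V y -> phi y = 1];
  cutoff_zero : exists K, [/\ closed K, K `<=` U & forall y, ~ K y -> phi y = 0]
}.

(** Extension by zero, in the form where f is already defined everywhere. *)
Lemma smooth_on_extend0 (U V K : set M) f : open U -> open V -> closed K ->
  K `<=` U -> smooth_on (U `&` V) f -> (forall y, ~ K y -> f y = 0) ->
  smooth_on V f.
Proof.
move=> oU oV cK KU sf f0; apply: smooth_on_local => x Vx.
have [Kx|nKx] := pselect (K x).
  exists (U `&` V), f; split => //; first exact: openI.
  by split=> //; exact: KU.
exists (~` K), (fun=> 0); split => //; first exact: closed_openC.
exact: smooth_on_cst.
Qed.

Lemma smooth_on_cutoffM x U V phi f : open U -> open V -> cutoff x U phi ->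
  smooth_on (U `&` V) f -> smooth_on V (fun y => phi y * f y).
Proof.
move=> oU oV [sp _ [K [cK KU p0]]] sf.
apply: (smooth_on_extend0 oU oV cK KU); last by move=> y /p0 ->; rewrite mul0r.
by apply: smooth_onM => //; [exact: openI | exact: smooth_onT].
Qed.

Lemma flat0_le (s t : R) : s <= t -> flat 0 s <= flat 0 t.
Proof.
move=> st; case: (leP s 0) => s0.
  by rewrite flat_le0// /flat; case: ifP => // _; rewrite expr0 mul1r expR_ge0.
have t0 := lt_le_trans s0 st.
by rewrite /flat s0 t0 !expr0 !mul1r ler_expR lerN2 lef_pV2.
Qed.

(** In a chart around x with squared distance q to x, the function
    k(q) = flat 0 (c0 - flat 0 (q - e)) / flat 0 c0, where c0 = flat 0 e, is 1
    for q <= e because the inner function vanishes there, and is 0 for q >= 2 e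
    because the argument of the outer one is then nonpositive. It vanishes off the
    image of a compact cube, which is closed in M since M is Hausdorff. *)
Lemma cutoff_exists x U : open U -> U x -> exists phi, cutoff x U phi.
Proof.
move=> oU Ux; have [c ac cx] := atlas_cover x.
set p := cmap c x.
have oW := @chart_image_open c _ oU.
have Wp : (cmap c @` (U `&` cdom c)) p by exists x.
have /nbhs_ballP[d /= d0 dW] := open_nbhs_nbhs (conj oW Wp).
pose q y : R := \sum_j (cmap c y 0 j - p 0 j) * (cmap c y 0 j - p 0 j).
have sq : smooth_on (cdom c) q.
  have oc := cdom_open c.
  apply: smooth_on_sum => // j _.
  by apply: smooth_onM => //; apply: smooth_onB => //;
    (exact: smooth_on_coord || exact: smooth_on_cst).
(* off the cube of half-side d / 2 one has q > d ^ 2 / 4 = 2 e *)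
pose e : R := d ^+ 2 / 8; have e0 : 0 < e by rewrite /e divr_gt0// exprn_gt0.
pose c0 : R := flat 0 e; have c00 : 0 < c0 by exact: flat0_gt0.
pose k (t : R) := flat 0 (c0 - flat 0 (t - e)) / flat 0 c0.
have k1 t : t <= e -> k t = 1.
  move=> te; rewrite /k (@flat_le0 _ 0 (t - e)) ?subr_le0// subr0 divff//.
  exact/lt0r_neq0/flat0_gt0.
have k0 t : 2 * e <= t -> k t = 0.
  move=> te; rewrite /k (@flat_le0 _ 0 (c0 - _)) ?mul0r// subr_le0.
  by apply: flat0_le; lra.
pose phi y : R := if pselect (cdom c y) then k (q y) else 0.
pose B := [set y : 'rV[R]_n | forall j, `[p 0 j - d / 2, p 0 j + d / 2]%classic (y 0 j)].
have cB : compact B.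
  apply: (@rV_compact R n (fun j => `[p 0 j - d / 2, p 0 j + d / 2]%classic)).
  by move=> j; exact: segment_compact.
have BW : B `<=` cmap c @` (U `&` cdom c).
  move=> y By; apply: dW; split=> // i j; rewrite (ord1 i).
  have := By j; rewrite /= in_itv/= => /andP[h1 h2].
  rewrite /ball/= ltr_norml; apply/andP; split; lra.
have cK : closed (cinv c @` B).
  apply: (compact_closed (manifold_hausdorff (m := M))).
  apply: continuous_compact => //; apply: continuous_in_subspaceT => y.
  rewrite inE => /BW[z [_ cz] <-]; apply: cinv_continuous.
  by exists z.
have KU : cinv c @` B `<=` U `&` cdom c.
  by move=> _ [y /BW [z [Uz cz] <-] <-]; rewrite cmapK.
have phi0 y : ~ (cinv c @` B) y -> phi y = 0.
  move=> nK; rewrite /phi; case: pselect => // cy; apply: k0.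
  rewrite leNgt; apply/negP => qe; apply: nK; exists (cmap c y); last exact: cmapK.
  move=> j; rewrite /= in_itv/=.
  have : (cmap c y 0 j - p 0 j) * (cmap c y 0 j - p 0 j) <= q y.
    rewrite /q (bigD1 j)//= lerDl; apply: sumr_ge0 => i _.
    by rewrite -expr2 sqr_ge0.
  set u := cmap c y 0 j; set v := p 0 j => uq.
  have d2 : 0 <= d / 2 by rewrite divr_ge0// ltW.
  have : `|u - v| <= d / 2.
    rewrite -(@ler_pXn2r _ 2) ?nnegrE// real_normK ?num_real// expr2.
    apply: (le_trans uq); rewrite /e in qe.
    have -> : (d / 2) ^+ 2 = 2 * (d ^+ 2 / 8) by field.
    exact: ltW.
  by rewrite ler_norml => /andP[h1 h2]; apply/andP; split; lra.
exists phi; split.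
- apply: (smooth_on_extend0 (@cdom_open _ _ _ c) openT cK _ _ phi0) => [y /KU[]//|].
  rewrite setIT.
  apply: (@smooth_on_eq _ _ (fun y => flat 0 (c0 - flat 0 (q y - e)) * (flat 0 c0)^-1)).
  + exact: cdom_open.
  + by move=> y cy; rewrite /phi; case: pselect.
  + have oc := cdom_open c.
    apply: smooth_onM => //; last exact: smooth_on_cst.
    apply: smooth_on_flat => //; apply: smooth_onB => //; first exact: smooth_on_cst.
    apply: smooth_on_flat => //; apply: smooth_onB => //; exact: smooth_on_cst.
- exists (cdom c `&` q @^-1` [set t | t < e]); split.
  + rewrite openE => y [cy qy]; rewrite /interior; apply: filterI.
      exact: open_nbhs_nbhs (conj (@cdom_open _ _ _ c) cy).
    have := smooth_on_continuous (@cdom_open _ _ _ c) sq cy; apply.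
    exact: lt_nbhsl.
  + split => //=; rewrite /q big1 ?e0// => j _; by rewrite subrr mul0r.
  + by move=> y [cy /= qy]; rewrite /phi; case: pselect => // ?; exact/k1/ltW.
- by exists (cinv c @` B); split => // y /KU[].
Qed.

Lemma cutoff_at x U phi : cutoff x U phi -> phi x = 1.
Proof. by case=> _ [V [_ Vx ->]]. Qed.

Lemma cutoff_off x U phi y : cutoff x U phi -> ~ U y -> phi y = 0.
Proof. by case=> _ _ [K [_ KU h]] nU; apply: h => /KU. Qed.

(** A purely algebraic trace of being 1 near x. Every derivation D at x kills
    such a phi: D chi = D (phi * chi) = D phi + D chi. *)
Lemma cutoff_absorb x U phi : cutoff x U phi ->
  exists chi, [/\ smooth chi, chi x = 1 & forall y, phi y * chi y = chi y].
Proof.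
case=> _ [V [oV Vx p1]] _; have [chi cchi] := cutoff_exists oV Vx.
exists chi; split; [exact: cutoff_smooth cchi | exact: cutoff_at cchi |].
move=> y; have [Vy|nVy] := pselect (V y); first by rewrite p1// mul1r.
by rewrite (cutoff_off cchi nVy) mulr0.
Qed.

End SmoothFunctions.

(** * Bases, dual bases and alternating 2-forms *)
Section DualBasis.
Variables (R : realType) (V : vectType R) (r : nat) (e : r.-tuple V).

Lemma dual_vecE i v : dual_vec e i v = coord e i v.
Proof. by rewrite /dual_vec lfunE. Qed.

Hypothesis be : basis_of fullv e.

Lemma vec_expand v : v = \sum_i coord e i v *: tnth e i.
Proof.
rewrite {1}(coord_basis be (memvf v)).
by apply: eq_bigr => i _; rewrite (tnth_nth 0).
Qed.

Lemma covec_expand (g : dual V) : g = \sum_i (g (tnth e i) : R) *: dual_vec e i.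
Proof.
apply/lfunP => v; rewrite sum_lfunE {1}(vec_expand v) linear_sum.
by apply: eq_bigr => i _; rewrite linearZ scale_lfunE dual_vecE; exact: mulrC.
Qed.

Lemma vec_sep (u v : V) : (forall g : dual V, g u = g v) -> u = v.
Proof.
move=> h; rewrite (vec_expand u) (vec_expand v).
by apply: eq_bigr => i _; rewrite -!dual_vecE h.
Qed.

Lemma covec_of (f : 'I_r -> R) :
  exists g : dual V, forall v, g v = \sum_i coord e i v * f i.
Proof.
exists (\sum_i f i *: dual_vec e i) => v.
by rewrite sum_lfunE; apply: eq_bigr => i _; rewrite scale_lfunE dual_vecE; exact: mulrC.
Qed.

End DualBasis.

Section Alternating2.
Variables (R : realType) (V : lmodType R) (P : seq V -> R).
Hypothesis aP : @Defs.alternating R V 2 P.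

Lemma alt2Dl u v w : P [:: u + v; w] = P [:: u; w] + P [:: v; w].
Proof. by have [_ /(_ [::] [:: w] 1 u v) + _] := aP; rewrite /= scale1r mul1r. Qed.

Lemma alt2Dr u v w : P [:: w; u + v] = P [:: w; u] + P [:: w; v].
Proof. by have [_ /(_ [:: w] [::] 1 u v) + _] := aP; rewrite /= scale1r mul1r. Qed.

Lemma alt2C u v : P [:: v; u] = - P [:: u; v].
Proof.
have d w : P [:: w; w] = 0 by have [_ _ /(_ [::] [::] [::] w)] := aP.
have := d (u + v); rewrite alt2Dl !alt2Dr !d add0r addr0 => h.
by apply/eqP; rewrite -subr_eq0 opprK addrC h.
Qed.

Lemma alt20l w : P [:: 0; w] = 0.
Proof. by have := alt2Dl 0 0 w; rewrite addr0 => h; lra. Qed.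

Lemma alt2Zl a u w : P [:: a *: u; w] = a * P [:: u; w].
Proof.
have [_ /(_ [::] [:: w] a u 0) + _] := aP.
by rewrite /= addr0 alt20l addr0.
Qed.

Lemma alt2Zr a u w : P [:: w; a *: u] = a * P [:: w; u].
Proof. by rewrite alt2C alt2Zl (alt2C w u) mulrN opprK. Qed.

Lemma alt2_suml (I : Type) (s : seq I) (F : I -> V) w :
  P [:: \sum_(i <- s) F i; w] = \sum_(i <- s) P [:: F i; w].
Proof.
elim: s => [|i s IH]; first by rewrite !big_nil alt20l.
by rewrite !big_cons alt2Dl IH.
Qed.

Lemma alt2_sumr (I : Type) (s : seq I) (F : I -> V) w :
  P [:: w; \sum_(i <- s) F i] = \sum_(i <- s) P [:: w; F i].
Proof.
by rewrite alt2C alt2_suml -sumrN; apply: eq_bigr => i _; rewrite (alt2C (F i)).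
Qed.

End Alternating2.

(** * Smooth sections of a vector bundle *)
Section Sections.
Variables (R : realType) (n : nat) (M : manifold R n) (r : nat).
Variable A : vector_bundle M r.
Implicit Types (a b : vfield A) (al be : covfield A) (P Q : mvfield A).

Lemma smooth_from_frames (f : M -> R) :
  (forall e : local_frame A r, frames e -> smooth_on (fdom e) f) -> smooth f.
Proof.
move=> h; apply: smooth_on_local => x _; have [e fe ex] := frames_cover A x.
by exists (fdom e), f; split => //; [exact: fdom_open fe | exact: h].
Qed.

Lemma smooth_pairing al b : smooth_cov al -> smooth_vec b ->
  smooth (fun y => al y (b y) : R).
Proof.
move=> sa sb; apply: smooth_from_frames => e fe; have oe := fdom_open fe.
apply: (@smooth_on_eq _ _ _ _ _
  (fun y => \sum_i coord (e y) i (b y) * al y (tnth (e y) i))) => //.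
  move=> y ey; rewrite {1}(vec_expand (frame_basis fe ey) (b y)) linear_sum.
  by apply: eq_bigr => i _; rewrite linearZ.
by apply: smooth_on_sum => // i _; apply: smooth_onM => //; [exact: sb | exact: sa].
Qed.

Lemma smooth_mv2 P al be : smooth_mv 2 P -> smooth_cov al -> smooth_cov be ->
  smooth (fun y => P y [:: al y; be y]).
Proof.
move=> [aP sP] sa sb; apply: smooth_from_frames => e fe; have oe := fdom_open fe.
apply: (@smooth_on_eq _ _ _ _ _ (fun y => \sum_i \sum_j
   al y (tnth (e y) i) * (be y (tnth (e y) j) *
     P y [seq dual_vec (e y) k | k <- [:: i; j]]))) => //.
  move=> y ey; have bs := frame_basis fe ey.
  rewrite {1}(covec_expand bs (al y)) {1}(covec_expand bs (be y)).
  rewrite (alt2_suml (aP y)); apply: eq_bigr => i _.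
  rewrite (alt2_sumr (aP y)); apply: eq_bigr => j _.
  by rewrite (alt2Zl (aP y)) (alt2Zr (aP y)).
apply: smooth_on_sum => // i _; apply: smooth_on_sum => // j _.
apply: smooth_onM => //; first exact: sa.
by apply: smooth_onM => //; [exact: sb | exact: sP].
Qed.

Lemma smooth_vecZ (phi : M -> R) b : smooth phi -> smooth_vec b ->
  smooth_vec (fun y => phi y *: b y : A y).
Proof.
move=> sp sb e fe i; have oe := fdom_open fe.
apply: (@smooth_on_eq _ _ _ _ _ (fun y => phi y * coord (e y) i (b y))) => //.
  by move=> y _; rewrite linearZ.
by apply: smooth_onM => //; [exact: smooth_onT | exact: sb].
Qed.

Lemma smooth_vecD a b : smooth_vec a -> smooth_vec b ->
  smooth_vec (fun y => a y + b y : A y).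
Proof.
move=> sa sb e fe i; have oe := fdom_open fe.
apply: (@smooth_on_eq _ _ _ _ _
  (fun y => coord (e y) i (a y) + coord (e y) i (b y))) => //.
  by move=> y _; rewrite linearD.
by apply: smooth_onD => //; [exact: sa | exact: sb].
Qed.

Lemma smooth_vec0 : smooth_vec (fun y => 0 : A y).
Proof.
move=> e fe i; apply: (@smooth_on_eq _ _ _ _ _ (fun=> 0)) => //.
- exact: fdom_open fe.
- by move=> y _; rewrite linear0.
- exact: smooth_on_cst.
Qed.

Lemma smooth_vec_sum (I : Type) (s : seq I) (F : I -> vfield A) :
  (forall i, smooth_vec (F i)) -> smooth_vec (fun y => \sum_(i <- s) F i y : A y).
Proof.
move=> sF; elim: s => [|i s IH].
  have -> : (fun y => \sum_(i <- [::]) F i y : A y) = (fun y => 0).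
    by apply/functional_extensionality_dep => y; rewrite big_nil.
  exact: smooth_vec0.
have -> : (fun y => \sum_(i <- i :: s) F i y : A y) =
    (fun y => F i y + \sum_(i <- s) F i y).
  by apply/functional_extensionality_dep => y; rewrite big_cons.
exact: smooth_vecD.
Qed.

Lemma smooth_covZ (phi : M -> R) al : smooth phi -> smooth_cov al ->
  smooth_cov (fun y => phi y *: al y).
Proof.
move=> sp sa e fe i; have oe := fdom_open fe.
apply: (@smooth_on_eq _ _ _ _ _ (fun y => phi y * al y (tnth (e y) i))) => //.
  by move=> y _; rewrite lfunE.
by apply: smooth_onM => //; [exact: smooth_onT | exact: sa].
Qed.

Lemma smooth_covD al be : smooth_cov al -> smooth_cov be ->
  smooth_cov (fun y => al y + be y).
Proof.
move=> sa sb e fe i; have oe := fdom_open fe.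
apply: (@smooth_on_eq _ _ _ _ _
  (fun y => al y (tnth (e y) i) + be y (tnth (e y) i))) => //.
  by move=> y _; rewrite lfunE.
by apply: smooth_onD => //; [exact: sa | exact: sb].
Qed.

Section LocalSections.
Variables (x : M) (e : local_frame A r) (phi : M -> R).
Hypotheses (fe : frames e) (ex : fdom e x) (cphi : cutoff x (fdom e) phi).

(** The frame vectors and their duals, cut off so as to be global smooth
    sections. *)
Definition frame_vec i : vfield A := fun y => phi y *: tnth (e y) i.
Definition frame_cov i : covfield A := fun y => phi y *: dual_vec (e y) i.

Lemma smooth_frame_vec i : smooth_vec (frame_vec i).
Proof.
move=> f ff j; have oe := fdom_open fe; have oF := fdom_open ff.
apply: (@smooth_on_eq _ _ _ _ _
  (fun y => phi y * coord (f y) j (tnth (e y) i))) => //.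
  by move=> y _; rewrite linearZ.
exact: (smooth_on_cutoffM oe oF cphi (frames_compatible fe ff i j)).
Qed.

Lemma smooth_frame_cov i : smooth_cov (frame_cov i).
Proof.
move=> f ff j; have oe := fdom_open fe; have oF := fdom_open ff.
apply: (@smooth_on_eq _ _ _ _ _
  (fun y => phi y * coord (e y) i (tnth (f y) j))) => //.
  by move=> y _; rewrite lfunE/= dual_vecE.
apply: (smooth_on_cutoffM oe oF cphi).
by rewrite setIC; exact: frames_compatible.
Qed.

Lemma smooth_frame_coord b i : smooth_vec b ->
  smooth (fun y => phi y * coord (e y) i (b y)).
Proof.
move=> sb; apply: (smooth_on_cutoffM (fdom_open fe) openT cphi).
by rewrite setIT; exact: sb.
Qed.

(** The two factors phi are shared between the coefficients and the sections,
    which makes both of them smooth on all of M. *)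
Lemma frame_vec_expand b y : phi y *: (phi y *: b y) =
  \sum_i (phi y * coord (e y) i (b y)) *: frame_vec i y.
Proof.
have [ey|ney] := pselect (fdom e y); last first.
  by rewrite (cutoff_off cphi ney) scale0r big1// => i _; rewrite mul0r scale0r.
rewrite {1}(vec_expand (frame_basis fe ey) (b y)) !scaler_sumr.
by apply: eq_bigr => i _; rewrite /frame_vec !scalerA; congr (_ *: _); ring.
Qed.

End LocalSections.

Lemma frame_at x : exists (e : local_frame A r) phi,
  [/\ frames e, fdom e x & cutoff x (fdom e) phi].
Proof.
have [e fe ex] := frames_cover A x.
have [phi c] := cutoff_exists (fdom_open fe) ex.
by exists e, phi.
Qed.

Lemma cov_extend x (g : dual (A x)) :
  exists2 al : covfield A, smooth_cov al & al x = g.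
Proof.
have [e [phi [fe ex c]]] := frame_at x.
exists (fun y => \sum_i (g (tnth (e x) i) : R) *: frame_cov e phi i y).
  elim: (index_enum _) => [|i s IH].
    move=> f ff j; apply: (@smooth_on_eq _ _ _ _ _ (fun=> 0)).
    - exact: fdom_open ff.
    - by move=> y _; rewrite big_nil lfunE.
    - exact: smooth_on_cst.
  have -> : (fun y => \sum_(i <- i :: s) (g (tnth (e x) i) : R) *: frame_cov e phi i y)
    = (fun y => (g (tnth (e x) i) : R) *: frame_cov e phi i y +
        \sum_(i <- s) (g (tnth (e x) i) : R) *: frame_cov e phi i y).
    by apply/functional_extensionality_dep => y; rewrite big_cons.
  apply: smooth_covD => //; apply: smooth_covZ; first exact: smooth_on_cst.
  exact: (smooth_frame_cov fe c i).
rewrite [RHS](covec_expand (frame_basis fe ex)); apply: eq_bigr => i _.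
by rewrite /frame_cov (cutoff_at c) scale1r.
Qed.

Lemma vec_eq_cov x (u v : A x) :
  (forall al, smooth_cov al -> al x u = al x v) -> u = v.
Proof.
move=> h; have [e fe ex] := frames_cover A x.
apply: (vec_sep (frame_basis fe ex)) => g.
by have [al sa <-] := cov_extend g; exact: h.
Qed.

(** A functional that is linear over functions, up to evaluation at x, depends
    only on the value at x: replacing b by phi^2 b does not change L b, and phi^2 b
    is a combination of finitely many fixed global sections. *)
Lemma tensorial x (L : vfield A -> R) :
  (forall phi a b, smooth phi -> smooth_vec a -> smooth_vec b ->
     L (fun y => phi y *: a y + b y) = phi x * L a + L b) ->
  exists g : dual (A x), forall b, smooth_vec b -> g (b x) = L b.
Proof.
move=> lin; have [e [phi [fe ex c]]] := frame_at x.
have [g gE] := covec_of (e x) (fun i => L (frame_vec e phi i)).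
exists g => b sb; rewrite gE.
have sphi := cutoff_smooth c.
have phi1 := cutoff_at c.
have L0 : L (fun y => 0 : A y) = 0.
  have := lin (fun=> 1) _ _ (@smooth_on_cst _ _ _ _ 1) smooth_vec0 smooth_vec0.
  have -> : (fun y => 1 *: 0 + 0 : A y) = (fun y => 0).
    by apply/functional_extensionality_dep => y; rewrite scaler0 addr0.
  by move=> h; lra.
have LZ f a : smooth f -> smooth_vec a -> L (fun y => f y *: a y) = f x * L a.
  move=> sf sa; rewrite -[RHS]addr0 -L0 -lin//; last exact: smooth_vec0.
  by congr L; apply/functional_extensionality_dep => y; rewrite addr0.
transitivity (L (fun y => phi y *: (phi y *: b y))); last first.
  by rewrite !LZ ?phi1 ?mul1r//; exact: smooth_vecZ.
rewrite (_ : (fun y => _) = (fun y =>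
    \sum_i (phi y * coord (e y) i (b y)) *: frame_vec e phi i y)); last first.
  by apply/functional_extensionality_dep => y; exact: (frame_vec_expand fe c).
elim: (index_enum _) => [|i s IH].
  rewrite big_nil -L0; congr L.
  by apply/functional_extensionality_dep => y; rewrite big_nil.
rewrite big_cons IH; symmetry.
rewrite (_ : (fun y => _) = (fun y => (phi y * coord (e y) i (b y)) *: frame_vec e phi i y +
    \sum_(i <- s) (phi y * coord (e y) i (b y)) *: frame_vec e phi i y)); last first.
  by apply/functional_extensionality_dep => y; rewrite big_cons.
rewrite (lin (fun y => phi y * coord (e y) i (b y))) ?phi1 ?mul1r//.
- exact: (smooth_frame_coord fe c _ sb).
- exact: (smooth_frame_vec fe c).
- apply: smooth_vec_sum => j; apply: smooth_vecZ; last exact: (smooth_frame_vec fe c).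
  exact: (smooth_frame_coord fe c _ sb).
Qed.

Lemma sharpE P al : smooth_mv 2 P -> forall x (g : dual (A x)),
  g (sharp P al x) = P x [:: al x; g].
Proof.
move=> [aP _] x; rewrite /sharp.
case: xgetP => [v -> //|]; move=> none; exfalso.
have [e fe ex] := frames_cover A x; have bs := frame_basis fe ex.
apply: (none (\sum_i P x [:: al x; dual_vec (e x) i] *: tnth (e x) i)) => g.
rewrite linear_sum [in RHS](covec_expand bs g) (alt2_sumr (aP x)).
by apply: eq_bigr => i _; rewrite linearZ (alt2Zr (aP x)); exact: mulrC.
Qed.

Lemma smooth_sharp P al : smooth_mv 2 P -> smooth_cov al ->
  smooth_vec (sharp P al).
Proof.
move=> sP sa e fe i; have oe := fdom_open fe; have [aP s] := sP.
apply: (@smooth_on_eq _ _ _ _ _ (fun y => \sum_j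
  al y (tnth (e y) j) * P y [seq dual_vec (e y) k | k <- [:: j; i]])) => //.
  move=> y ey; rewrite -dual_vecE (sharpE _ sP).
  rewrite {1}(covec_expand (frame_basis fe ey) (al y)) (alt2_suml (aP y)).
  by apply: eq_bigr => j _; rewrite (alt2Zl (aP y)).
apply: smooth_on_sum => // j _; apply: smooth_onM => //; [exact: sa | exact: s].
Qed.

End Sections.

(** * Calculus of a skew algebroid *)
Section Algebroid.
Variables (R : realType) (n : nat) (M : manifold R n) (r : nat).
Variables (A : vector_bundle M r) (G : skew_algebroid A).
Implicit Types (a b c : vfield A) (al be : covfield A) (P Q : mvfield A).
Implicit Types (f g phi : M -> R).

Section AtPoint.
Variable x : M.
Implicit Types (u v : A x).

Lemma anchorDf v f g : smooth f -> smooth g ->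
  anchor G v (fun y => f y + g y) = anchor G v f + anchor G v g.
Proof.
move=> sf sg; have [h _] := anchor_tangent G v.
rewrite -[anchor G v f]mul1r -h//; congr anchor.
by apply/funext => y; rewrite mul1r.
Qed.

Lemma anchorMf v f g : smooth f -> smooth g ->
  anchor G v (fun y => f y * g y) = f x * anchor G v g + anchor G v f * g x.
Proof. by move=> sf sg; have [_ ->] := anchor_tangent G v. Qed.

Lemma anchor_cst v (k : R) : anchor G v (fun=> k) = 0.
Proof.
have s t := @smooth_on_cst _ _ M setT t.
have [h1 h2] := anchor_tangent G v.
have e1 : anchor G v (fun=> 1) = 0.
  have := h2 _ _ (s 1) (s 1); rewrite !mul1r mulr1 => h; lra.
have e0 : anchor G v (fun=> 0) = 0.
  by have := h2 _ _ (s 0) (s 0); rewrite !mul0r mulr0 addr0.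
have := h1 k _ _ (s 1) (s 0).
by rewrite e1 e0 mulr0 mulr1 !addr0.
Qed.

Lemma anchorZf v (k : R) f : smooth f ->
  anchor G v (fun y => k * f y) = k * anchor G v f.
Proof.
move=> sf; rewrite (@anchorMf v (fun=> k) f) ?anchor_cst ?mul0r ?addr0//.
exact: smooth_on_cst.
Qed.

Lemma anchorNf v f : smooth f -> anchor G v (fun y => - f y) = - anchor G v f.
Proof.
move=> sf; rewrite -mulN1r -anchorZf//; congr anchor.
by apply/funext => y; rewrite mulN1r.
Qed.

Lemma anchorBf v f g : smooth f -> smooth g ->
  anchor G v (fun y => f y - g y) = anchor G v f - anchor G v g.
Proof.
move=> sf sg; rewrite (@anchorDf v f (fun y => - g y)) ?anchorNf//.
exact: smoothN.
Qed.

Lemma anchorD u v f : smooth f -> anchor G (u + v) f = anchor G u f + anchor G v f.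
Proof. by move=> sf; rewrite -[u]scale1r anchor_linear// mul1r scale1r. Qed.

Lemma anchor0 f : smooth f -> anchor G (0 : A x) f = 0.
Proof. by move=> sf; have := anchorD 0 0 sf; rewrite addr0 => h; lra. Qed.

Lemma anchorZ (k : R) u f : smooth f -> anchor G (k *: u) f = k * anchor G u f.
Proof. by move=> sf; rewrite -[k *: u]addr0 anchor_linear// anchor0// addr0. Qed.

Lemma anchor_absorbed v f g : smooth f -> smooth g -> g x = 1 ->
  (forall y, f y * g y = g y) -> anchor G v f = 0.
Proof.
move=> sf sg g1 fg; have := anchorMf v sf sg.
have fx : f x = 1 by have := fg x; rewrite g1 mulr1.
have -> : (fun y => f y * g y) = g by apply/funext.
by rewrite fx g1 mul1r mulr1 => h; lra.
Qed.

Lemma d_rhoE f v : smooth f -> d_rho G f x v = anchor G v f.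
Proof.
move=> sf.
have lin : linear_for *:%R (fun v : A x => anchor G v f : R^o).
  by move=> k u w; rewrite anchor_linear.
pose L : {linear A x -> R^o} := HB.pack (fun v : A x => anchor G v f : R^o)
  (GRing.isLinear.Build R (A x) R^o *:%R (fun v : A x => anchor G v f : R^o) lin).
exact: (lfunE L v).
Qed.

End AtPoint.

Lemma bracketC a b x : smooth_vec a -> smooth_vec b ->
  bracket G a b x = - bracket G b a x.
Proof. by move=> sa sb; exact: bracket_skew. Qed.

Lemma bracketDr a b c x : smooth_vec a -> smooth_vec b -> smooth_vec c ->
  bracket G a (fun y => b y + c y) x = bracket G a b x + bracket G a c x.
Proof.
move=> sa sb sc; rewrite -[bracket G a b x]scale1r -bracket_linearr//.
by congr (bracket G a _ x); apply/functional_extensionality_dep => y; rewrite scale1r.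
Qed.

Lemma bracketZr a f b x : smooth f -> smooth_vec a -> smooth_vec b ->
  bracket G a (fun y => f y *: b y) x =
    f x *: bracket G a b x + anchor G (a x) f *: b x.
Proof. by move=> sf sa sb; rewrite bracket_leibniz. Qed.

Lemma bracketDl a b c x : smooth_vec a -> smooth_vec b -> smooth_vec c ->
  bracket G (fun y => b y + c y) a x = bracket G b a x + bracket G c a x.
Proof.
move=> sa sb sc; rewrite bracketC ?bracketDr//; last exact: smooth_vecD.
by rewrite opprD -!bracketC.
Qed.

Lemma bracketZl a f b x : smooth f -> smooth_vec a -> smooth_vec b ->
  bracket G (fun y => f y *: b y) a x =
    f x *: bracket G b a x - anchor G (a x) f *: b x.
Proof.
move=> sf sa sb; rewrite bracketC ?bracketZr//; last exact: smooth_vecZ.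
by rewrite opprD -scalerN -bracketC.
Qed.

Lemma bracket_self a x : smooth_vec a -> bracket G a a x = 0.
Proof.
move=> sa; have h := bracketC x sa sa.
have : (2 : R) *: bracket G a a x = 0.
  by rewrite scaler_nat mulr2n {1}h addNr.
by move/eqP; rewrite scaler_eq0 pnatr_eq0 => /orP[//|/eqP].
Qed.

(** Comparing [a, f X] with f [a, X] for a section X without zeros near the
    point expresses rho(a) f through smooth sections. This avoids differentiating
    f in one chart and reading the result in another. *)
Lemma smooth_anchor a f : smooth_vec a -> smooth f ->
  smooth (fun y => anchor G (a y) f).
Proof.
move=> sa sf; apply: smooth_on_local => x _.
have [e [phi [fe ex c]]] := frame_at A x; have oe := fdom_open fe.
(* in rank 0 there is no such X, but then a = 0 *)
have [r0|r0] := posnP r.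
  exists (fdom e), (fun=> 0); split => //; first exact: smooth_on_cst.
  move=> y ey; rewrite (vec_expand (frame_basis fe ey) (a y)) big1 ?anchor0//.
  by move=> [i lt_i]; exfalso; move: lt_i; rewrite r0.
pose i := Ordinal r0; have [V [oV Vx p1]] := cutoff_one c.
have [X [sX X1]] : exists X : vfield A, smooth_vec X /\
    forall y, V y -> fdom e y -> coord (e y) i (X y) = 1.
  exists (frame_vec e phi i); split; first exact: (smooth_frame_vec fe c i).
  move=> y Vy ey; rewrite /frame_vec p1// scale1r (tnth_nth 0).
  by rewrite (coord_free _ _ (basis_free (frame_basis fe ey))) eqxx.
exists (V `&` fdom e), (fun y => coord (e y) i (bracket G a (fun z => f z *: X z) y)
   - f y * coord (e y) i (bracket G a X y)); split.
- exact: openI.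
- by [].
- have o := openI oV oe; apply: smooth_onB => //.
    apply: (smooth_on_subset _ (bracket_smooth G sa (smooth_vecZ sf sX) fe i)).
    by move=> y [].
  apply: smooth_onM => //; first exact: smooth_onT.
  by apply: (smooth_on_subset _ (bracket_smooth G sa sX fe i)) => y [].
- move=> y [Vy ey]; rewrite bracketZr// linearD !linearZ /= X1//.
  rewrite /GRing.scale/=; ring.
Qed.

(** The defining condition has a solution because its right-hand side is
    tensorial in b: the two derivatives of the coefficient cancel. *)
Lemma lie_covE a al : smooth_vec a -> smooth_cov al ->
  forall b x, smooth_vec b ->
  lie_cov G a al x (b x) = anchor G (a x) (fun y => al y (b y)) - al x (bracket G a b x).
Proof.
move=> sa sal b x sb; rewrite /lie_cov.
case: xgetP => [g -> /(_ b sb)//|none]; exfalso.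
have [phi_ c d sphi sc sd|g gE] := @tensorial _ _ _ _ A x
  (fun b => anchor G (a x) (fun y => al y (b y)) - al x (bracket G a b x)).
  rewrite bracketDr//; last exact: smooth_vecZ.
  rewrite bracketZr//.
  have -> : (fun y => al y (phi_ y *: c y + d y) : R) =
      (fun y => phi_ y * al y (c y) + al y (d y)).
    by apply/funext => y; rewrite linearD linearZ.
  have h1 := smooth_pairing sal sc; have h2 := smooth_pairing sal sd.
  rewrite (@anchorDf x (a x) (fun y => phi_ y * al y (c y)) (fun y => al y (d y)))//; last exact: smoothM.
  rewrite (@anchorMf x (a x) phi_ (fun y => al y (c y)))//.
  rewrite !linearD !linearZ /=.
  rewrite /GRing.scale/=; ring.
exact: (none g gE).
Qed.

(** On a frame vector, the value agrees near x with the one on the cut-off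
    frame vector, which is a global section. *)
Lemma smooth_lie_cov a al : smooth_vec a -> smooth_cov al ->
  smooth_cov (lie_cov G a al).
Proof.
move=> sa sal e fe i; apply: smooth_on_local => x ex.
have oe := fdom_open fe; have [phi c] := cutoff_exists oe ex.
have sX := smooth_frame_vec fe c i.
have [V [oV Vx p1]] := cutoff_one c.
exists V, (fun y => anchor G (a y) (fun y => al y (frame_vec e phi i y)) -
   al y (bracket G a (frame_vec e phi i) y)); split => //.
  apply: smooth_onT; apply: smooth_onB; first exact: openT.
    by apply: smooth_anchor => //; exact: smooth_pairing.
  by apply: smooth_pairing => //; exact: bracket_smooth.
by move=> y Vy; rewrite -lie_covE// /frame_vec p1// scale1r.
Qed.

Lemma koszulE P al be b x : smooth_mv 2 P -> smooth_cov al -> smooth_cov be ->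
  smooth_vec b ->
  koszul G P al be x (b x) =
    anchor G (sharp P al x) (fun y => be y (b y)) - be x (bracket G (sharp P al) b x)
    - (anchor G (sharp P be x) (fun y => al y (b y)) - al x (bracket G (sharp P be) b x))
    - anchor G (b x) (fun y => P y [:: al y; be y]).
Proof.
move=> sP sa sb s; rewrite /koszul !add_lfunE !opp_lfunE d_rhoE; last exact: smooth_mv2.
by rewrite !lie_covE//; exact: smooth_sharp.
Qed.

End Algebroid.

(** * Shuffle products and the pairing in low degree *)
Section Wedge.
Variables (R : realType) (V : lmodType R).
Implicit Types (f g : seq V -> R) (s : seq V).

Lemma wedge0l f g s : (forall t, f t = 0) -> wedge f g s = 0.
Proof.
elim: s f g => [|v s IH] f g f0 /=; first by rewrite f0 mul0r.
by rewrite !IH ?addr0// => t; rewrite f0 ?mulr0.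
Qed.

Lemma wedge0r f g s : (forall t, g t = 0) -> wedge f g s = 0.
Proof.
elim: s f g => [|v s IH] f g g0 /=; first by rewrite g0 mulr0.
by rewrite !IH ?addr0// => t; rewrite g0.
Qed.

(** Convertible to the value of [fun_mv] at a point. *)
Definition scalar_form (k : R) s : R := if s is [::] then k else 0.

Lemma wedge_scalarl k g s : wedge (scalar_form k) g s = k * g s.
Proof.
elim: s g => [//|v s IH] g /=; rewrite wedge0l// add0r.
rewrite -(IH (fun u => g (v :: u))); congr wedge.
by apply/funext => -[|w u] /=; rewrite ?expr0 ?mul1r ?mulr0.
Qed.

Lemma wedge_scalarr k f s : wedge f (scalar_form k) s = f s * k.
Proof.
elim: s f => [//|v s IH] f /=.
by rewrite (wedge0r _ (g := fun u => 0))// addr0 IH.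
Qed.

Lemma wedge_degree k l f g s :
  (forall t, size t <> k -> f t = 0) -> (forall t, size t <> l -> g t = 0) ->
  size s <> (k + l)%N -> wedge f g s = 0.
Proof.
elim: s k l f g => [|v s IH] k l f g fk gl sz /=.
  case: k fk sz => [|k] fk sz; last by rewrite fk ?mul0r.
  by rewrite gl ?mulr0.
have -> : wedge (fun u => f (v :: u)) g s = 0.
  case: k fk sz => [|k] fk sz; first by apply: wedge0l => t; exact: fk.
  apply: (IH k l) => //; last by move=> h; apply: sz; rewrite /= h.
  by move=> t tk; apply: fk => -[].
rewrite add0r; case: l gl sz => [|l] gl sz; first by apply: wedge0r => t; exact: gl.
apply: (IH k l).
- by move=> t tk; rewrite fk ?mulr0.
- by move=> t tl; apply: gl => -[].
- by move=> h; apply: sz; rewrite /= h addnS.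
Qed.

Lemma wedge11 f g u v :
  (forall t, size t <> 1%N -> f t = 0) -> (forall t, size t <> 1%N -> g t = 0) ->
  wedge f g [:: u; v] = f [:: u] * g [:: v] - f [:: v] * g [:: u].
Proof.
move=> f1 g1 /=; rewrite ?expr0 ?expr1.
rewrite (f1 [::])// (g1 [::])// (f1 [:: u; v])// (g1 [:: u; v])//; ring.
Qed.

Lemma wedge21 f g u v w :
  (forall t, size t <> 2%N -> f t = 0) -> (forall t, size t <> 1%N -> g t = 0) ->
  wedge f g [:: u; v; w] =
    f [:: u; v] * g [:: w] - f [:: u; w] * g [:: v] + f [:: v; w] * g [:: u].
Proof.
move=> f2 g1 /=; rewrite (f2 [::])// (f2 [:: u])// (f2 [:: v])// (f2 [:: w])//.
rewrite (f2 [:: u; v; w])// (g1 [::])//; ring.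
Qed.

Lemma wedge12 f g u v w :
  (forall t, size t <> 1%N -> f t = 0) -> (forall t, size t <> 2%N -> g t = 0) ->
  wedge f g [:: u; v; w] =
    f [:: u] * g [:: v; w] - f [:: v] * g [:: u; w] + f [:: w] * g [:: u; v].
Proof.
move=> f1 g2 /=; rewrite (g2 [::])// (g2 [:: u])// (g2 [:: v])// (g2 [:: w])//.
rewrite (g2 [:: u; v; w])// (f1 [::])//; ring.
Qed.

End Wedge.

Section Pairing1.
Variables (R : realType) (V : vectType R).

Definition covec_form (g : dual V) (s : seq V) : R :=
  if s is [:: v] then g v else 0.

Lemma alternating_covec_form g : Defs.alternating 1 (covec_form g).
Proof.
split.
- by move=> [|v [|w s]].
- move=> [|w [|z s1]] [|y s2] k u v //=; rewrite ?mulr0 ?addr0//.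
  by rewrite linearD linearZ.
- by move=> [|w [|z s1]] [|y s2] s3 u.
Qed.

(** Only singletons contribute to the sum over index sets, and the remaining
    sum is the expansion of g in the dual basis. *)
Lemma pairing1 (P : seq (dual V) -> R) g :
  Defs.alternating 1 P -> pairing P (covec_form g) = P [:: g].
Proof.
move=> [P1 Plin _].
have bs := vbasisP (fullv : {vspace V}).
have PD u v : P [:: u + v] = P [:: u] + P [:: v].
  by have := Plin [::] [::] 1 u v; rewrite /= scale1r mul1r.
have P0 : P [:: 0] = 0 by have := PD 0 0; rewrite addr0 => h; lra.
have PZ k u : P [:: k *: u] = k * P [:: u].
  by have := Plin [::] [::] k u 0; rewrite /= addr0 P0 addr0.
rewrite /pairing.
rewrite (bigID (fun I : {set 'I__} => I \in [set [set i] | i in [set: 'I_(\dim (fullv : {vspace V}))]]%SET)) /=.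
rewrite [X in _ + X]big1 ?addr0; last first.
  move=> I nI; rewrite P1 ?mul0r// size_map -cardE => /eqP/cards1P[i Ii].
  by move/negP: nI; apply; rewrite Ii imset_f.
rewrite big_imset/=; last by move=> i j _ _ /set1_inj.
rewrite [in RHS](covec_expand bs g).
transitivity (\sum_i g (tnth (vbasis fullv) i) * P [:: dual_vec (vbasis fullv) i] : R).
  apply: eq_big => [i|i _]; first by rewrite inE.
  by rewrite enum_set1 /= mulrC.
elim: (index_enum _) => [|i s IH]; first by rewrite !big_nil.
by rewrite !big_cons PD PZ IH.
Qed.

End Pairing1.

(** * Bivector fields *)
Section Multivectors.
Variables (R : realType) (n : nat) (M : manifold R n) (r : nat).
Variables (A : vector_bundle M r).
Implicit Types (a b c : vfield A) (al be : covfield A) (P Q : mvfield A).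
Implicit Types (f g phi chi : M -> R).

Definition mv_lin (k : R) P Q : mvfield A := fun y s => k * P y s + Q y s.
Definition mv_scale f P : mvfield A := fun y s => f y * P y s.
Definition wedge_vec a b : mvfield A :=
  fun y => wedge (vec_mv a y) (vec_mv b y).

Arguments mv_lin k P Q x s : clear implicits.
Arguments mv_scale f P x s : clear implicits.
Arguments wedge_vec a b x s : clear implicits.

Lemma degree_mv k P x s : smooth_mv k P -> size s <> k -> P x s = 0.
Proof. by move=> [/(_ x)[h _ _] _] /h. Qed.

Lemma vec_mv_degree a x s : size s <> 1%N -> vec_mv a x s = 0.
Proof. by case: s => [|v [|w s]]. Qed.

Lemma smooth_fun_mv f : smooth f -> smooth_mv 0 (@fun_mv _ _ _ _ A f).
Proof.
move=> sf; split=> [x|e fe [|i s]]; last 2 first.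
- exact: smooth_onT.
- exact: smooth_on_cst.
by split=> [[]|[|w s1] s2 k u v|[|w s1] s2 s3 u]//=; rewrite mulr0 addr0.
Qed.

Lemma smooth_vec_mv a : smooth_vec a -> smooth_mv 1 (vec_mv a).
Proof.
move=> sa; split=> [x|e fe [|i [|j s]]].
- split.
  + by move=> s; exact: vec_mv_degree.
  + move=> [|w [|z s1]] [|y s2] k u v //=; rewrite ?mulr0 ?addr0//.
    by rewrite add_lfunE scale_lfunE.
  + by move=> [|w [|z s1]] [|y s2] s3 u.
- exact: smooth_on_cst.
- apply: (smooth_on_eq (fdom_open fe) _ (sa e fe i)) => y _ /=.
  by rewrite dual_vecE.
- exact: smooth_on_cst.
Qed.

Lemma wedge_vecE a b x (u v : dual (A x)) :
  wedge_vec a b x [:: u; v] = u (a x) * v (b x) - v (a x) * u (b x).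
Proof. by rewrite /wedge_vec wedge11//; exact: vec_mv_degree. Qed.

Lemma wedge_vec_degree a b x s : size s <> 2%N -> wedge_vec a b x s = 0.
Proof. by move=> s2; apply: (@wedge_degree _ _ 1 1) => //; exact: vec_mv_degree. Qed.

Lemma smooth_wedge_vec a b : smooth_vec a -> smooth_vec b ->
  smooth_mv 2 (wedge_vec a b).
Proof.
move=> sa sb; split=> [x|e fe s].
  split.
  + by move=> s; exact: wedge_vec_degree.
  + move=> s1 s2 k u v.
    have [] := eqVneq (size s1 + (size s2).+1)%N 2%N => [|/eqP ne]; last first.
      by rewrite !wedge_vec_degree ?mulr0 ?addr0// size_cat.
    case: s1 => [|w [|z s1]] /=; rewrite ?addSn ?add0n; last first.
    * by case: s1 => [|? ?]; rewrite ?addSn// !addnS.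
    * case: s2 => // _; rewrite !wedge_vecE !add_lfunE !scale_lfunE /GRing.scale/=.
      by ring.
    * case: s2 => [|w [|z s2]]// _; rewrite !wedge_vecE !add_lfunE !scale_lfunE.
      by rewrite /GRing.scale/=; ring.
  + move=> [|w s1] [|y s2] [|z s3] u; try by rewrite wedge_vec_degree//= ?size_cat/=;
      rewrite ?addnS.
    by rewrite /= wedge_vecE; ring.
have oe := fdom_open fe.
have [s2|ne] := eqVneq (size s) 2%N; last first.
  apply: (@smooth_on_eq _ _ _ _ _ (fun=> 0)) => // [y _|].
    by rewrite wedge_vec_degree// size_map; exact/eqP.
  exact: smooth_on_cst.
case: s s2 => [|i [|j [|]]]// _.
apply: (@smooth_on_eq _ _ _ _ _ (fun y => coord (e y) i (a y) * coord (e y) j (b y)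
   - coord (e y) j (a y) * coord (e y) i (b y))) => // [y _|].
  by rewrite /= wedge_vecE !dual_vecE.
by apply: smooth_onB => //; apply: smooth_onM => //; (exact: sa || exact: sb).
Qed.

Lemma smooth_mv_lin l k P Q : smooth_mv l P -> smooth_mv l Q ->
  smooth_mv l (mv_lin k P Q).
Proof.
move=> [aP sP] [aQ sQ]; split=> [x|e fe s].
  have [p1 p2 p3] := aP x; have [q1 q2 q3] := aQ x; split.
  - by move=> s sl; rewrite /mv_lin p1// q1// mulr0 addr0.
  - by move=> s1 s2 c u v; rewrite /mv_lin p2 q2; ring.
  - by move=> s1 s2 s3 u; rewrite /mv_lin p3 q3 mulr0 addr0.
have oe := fdom_open fe; apply: smooth_onD => //; last exact: sQ.
by apply: smooth_onM => //; [exact: smooth_on_cst | exact: sP].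
Qed.

Lemma smooth_mv_scale l f P : smooth f -> smooth_mv l P ->
  smooth_mv l (mv_scale f P).
Proof.
move=> sf [aP sP]; split=> [x|e fe s].
  have [p1 p2 p3] := aP x; split.
  - by move=> s sl; rewrite /mv_scale p1// mulr0.
  - by move=> s1 s2 c u v; rewrite /mv_scale p2; ring.
  - by move=> s1 s2 s3 u; rewrite /mv_scale p3 mulr0.
have oe := fdom_open fe; apply: smooth_onM => //; last exact: sP.
exact: smooth_onT.
Qed.

Lemma mv_scale_wedge f P : mv_scale f P =
  (fun y => wedge (fun_mv f y) (P y)).
Proof.
apply/functional_extensionality_dep => y; apply/funext => s.
exact/esym/wedge_scalarl.
Qed.

Lemma sharp_eq P al x (v : A x) : smooth_mv 2 P ->
  (forall g : dual (A x), g v = P x [:: al x; g]) -> sharp P al x = v.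
Proof.
move=> sP h; have [e fe ex] := frames_cover A x.
by apply: (vec_sep (frame_basis fe ex)) => g; rewrite (sharpE _ sP) h.
Qed.

Lemma sharp_lin k P Q al : smooth_mv 2 P -> smooth_mv 2 Q ->
  sharp (mv_lin k P Q) al = (fun y => k *: sharp P al y + sharp Q al y).
Proof.
move=> sP sQ; apply/functional_extensionality_dep => y.
apply: sharp_eq => [|g]; first exact: smooth_mv_lin.
by rewrite linearD linearZ /= !(sharpE _ sP) !(sharpE _ sQ).
Qed.

Lemma sharp_scale f P al : smooth f -> smooth_mv 2 P ->
  sharp (mv_scale f P) al = (fun y => f y *: sharp P al y).
Proof.
move=> sf sP; apply/functional_extensionality_dep => y.
apply: sharp_eq => [|g]; first exact: smooth_mv_scale.
by rewrite linearZ /= !(sharpE _ sP).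
Qed.

Lemma sharp_wedge a b al : smooth_vec a -> smooth_vec b ->
  sharp (wedge_vec a b) al =
    (fun y => (al y (a y) : R) *: b y + - (al y (b y) : R) *: a y).
Proof.
move=> sa sb; apply/functional_extensionality_dep => y.
apply: sharp_eq => [|g]; first exact: smooth_wedge_vec.
by rewrite linearD !linearZ /= wedge_vecE /GRing.scale/=; ring.
Qed.

(** Induction on bivector fields, at a point x. If D is linear, blind to factors
    that are 1 near x, and zero on decomposable fields, then it vanishes, because
    phi^2 P = 1/2 sum_i (phi e_i) /\ #P (phi e^i) for a frame e with dual frame
    e^i and a cutoff phi; all the sections on the right are global. *)
Lemma bivector_ind x (D : mvfield A -> R) :
  (forall k P Q, smooth_mv 2 P -> smooth_mv 2 Q ->
     D (mv_lin k P Q) = k * D P + D Q) ->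
  (forall phi chi P, smooth phi -> smooth chi -> smooth_mv 2 P -> chi x = 1 ->
     (forall y, phi y * chi y = chi y) -> D (mv_scale phi P) = D P) ->
  (forall a b, smooth_vec a -> smooth_vec b -> D (wedge_vec a b) = 0) ->
  forall P, smooth_mv 2 P -> D P = 0.
Proof.
move=> Dlin Dloc Dwedge P sP; have [aP _] := sP.
have [e [phi [fe ex c]]] := frame_at A x; have sphi := cutoff_smooth c.
have [chi [schi chi1 pc]] := cutoff_absorb c.
rewrite -(Dloc phi chi)// -(Dloc phi chi)//; last exact: smooth_mv_scale.
pose W i := wedge_vec (fun y => 2^-1 *: frame_vec e phi i y)
                      (sharp P (frame_cov e phi i)).
have sW1 i : smooth_vec (fun y => 2^-1 *: frame_vec e phi i y : A y).
  by apply: smooth_vecZ; [exact: smooth_on_cst | exact: (smooth_frame_vec fe c)].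
have sW2 i : smooth_vec (sharp P (frame_cov e phi i)).
  by apply: smooth_sharp => //; exact: (smooth_frame_cov fe c).
have sW i : smooth_mv 2 (W i) by exact: smooth_wedge_vec.
have -> : mv_scale phi (mv_scale phi P) = (fun y s => \sum_i W i y s).
  apply/functional_extensionality_dep => y; apply/funext => s; rewrite /mv_scale.
  have [s2|/eqP ne] := eqVneq (size s) 2%N; last first.
    rewrite (degree_mv sP ne) !mulr0 big1// => i _.
    by rewrite /W wedge_vec_degree.
  case: s s2 => [|u [|v [|]]]// _.
  have [ey|ney] := pselect (fdom e y); last first.
    rewrite (cutoff_off c ney) mul0r big1// => i _.
    rewrite /W wedge_vecE !(sharpE _ sP) /frame_vec /frame_cov (cutoff_off c ney).
    by rewrite !scale0r scaler0 !linear0 !mul0r subr0.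
  have bs := frame_basis fe ey.
  have frame_sum (u' v' : dual (A y)) : \sum_i u' (frame_vec e phi i y) *
      v' (sharp P (frame_cov e phi i) y) = phi y * (phi y * P y [:: u'; v']) :> R.
    rewrite [in RHS](covec_expand bs u') (alt2_suml (aP y)) !mulr_sumr.
    apply: eq_bigr => i _; rewrite (sharpE _ sP) /frame_vec /frame_cov linearZ.
    by rewrite !(alt2Zl (aP y)) /= /GRing.scale/=; ring.
  (* the two terms of a /\ b contribute equally, P being alternating *)
  transitivity (2^-1 * (phi y * (phi y * P y [:: u; v]) -
                        phi y * (phi y * P y [:: v; u]))).
    by rewrite (alt2C (aP y) u v); field.
  rewrite -!frame_sum -sumrB mulr_sumr; apply: eq_bigr => i _.
  by rewrite /W wedge_vecE !linearZ /= /GRing.scale/=; ring.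
pose Z : mvfield A := fun _ _ => 0.
have sZ : smooth_mv 2 Z.
  split; first by move=> y; split=> *; rewrite /Z ?mulr0 ?addr0.
  by move=> *; exact: smooth_on_cst.
have D0 : D Z = 0.
  have := Dlin 1 _ _ sZ sZ.
  have -> : mv_lin 1 Z Z = Z.
    apply/functional_extensionality_dep => y; apply/funext => s.
    by rewrite /mv_lin /Z mulr0 addr0.
  by move=> h; lra.
suff [] : D (fun y s => \sum_i W i y s) = 0 /\
    smooth_mv 2 (fun y s => \sum_i W i y s) by [].
elim: (index_enum _) => [|i s [IH1 IH2]].
  have -> : (fun y s => \sum_(i <- [::]) W i y s) = Z; last by [].
  by apply/functional_extensionality_dep => y; apply/funext => s; rewrite big_nil.
have -> : (fun y t => \sum_(j <- i :: s) W j y t) =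
    mv_lin 1 (W i) (fun y t => \sum_(j <- s) W j y t).
  apply/functional_extensionality_dep => y; apply/funext => t.
  by rewrite big_cons /mv_lin mul1r.
split; last exact: smooth_mv_lin.
by rewrite Dlin// IH1 Dwedge// mulr0 addr0.
Qed.

End Multivectors.

Arguments mv_lin {R n M r A} k P Q x s.
Arguments mv_scale {R n M r A} f P x s.
Arguments wedge_vec {R n M r A} a b x s.

(** * Values of the Schouten bracket *)
Section Schouten.
Variables (R : realType) (n : nat) (M : manifold R n) (r : nat).
Variables (A : vector_bundle M r) (G : skew_algebroid A).
Variable (S : mvfield A -> mvfield A -> mvfield A).
Arguments S : clear implicits.
Hypothesis SP : is_schouten G S.
Implicit Types (a b c : vfield A) (al be : covfield A) (P Q : mvfield A).
Implicit Types (f g phi chi : M -> R).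

Lemma schouten_mv_lin k l (c : R) P Q T x s : smooth_mv k P ->
  smooth_mv l Q -> smooth_mv l T ->
  S P (mv_lin c Q T) x s = c * S P Q x s + S P T x s.
Proof. by move=> sP sQ sT; exact: (schouten_linearr SP c sP sQ sT). Qed.

(** The product rule for f * g = g, as in [cutoff_absorb]. *)
Lemma schouten_absorbed k P f g x s : smooth_mv k P -> smooth f -> smooth g ->
  g x = 1 -> (forall y, f y * g y = g y) -> S P (fun_mv f) x s = 0.
Proof.
move=> sP sf sg g1 fg.
have := schouten_wedge SP sP (smooth_fun_mv A sf) (smooth_fun_mv A sg) s.
rewrite -mv_scale_wedge.
have -> : mv_scale f (fun_mv g) = fun_mv g :> mvfield A.
  apply/functional_extensionality_dep => y; apply/funext => -[|v t].
    by rewrite /mv_scale/= fg.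
  by rewrite /mv_scale/= mulr0.
rewrite muln0 expr0 mul1r (wedge_scalarl (f x)) (wedge_scalarr (g x)).
have fx : f x = 1 by have := fg x; rewrite g1 mulr1.
by rewrite fx g1 mulr1 mul1r => h; lra.
Qed.

Lemma schouten_local k l P Q f g x s : smooth_mv k P -> smooth_mv l Q ->
  smooth f -> smooth g ->
  g x = 1 -> (forall y, f y * g y = g y) -> S P (mv_scale f Q) x s = S P Q x s.
Proof.
move=> sP sQ sf sg g1 fg; rewrite mv_scale_wedge.
rewrite (schouten_wedge SP sP (smooth_fun_mv A sf) sQ).
rewrite wedge0l ?add0r; last first.
  by move=> t; exact: (schouten_absorbed t sP sf sg g1 fg).
have fx : f x = 1 by have := fg x; rewrite g1 mulr1.
by rewrite muln0 expr0 mul1r (wedge_scalarl (f x)) fx mul1r.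
Qed.

(** The Lie derivative of a vector field is characterised by its pairing with
    1-forms; that the Lie derivative of a smooth 1-form is a smooth 1-form is what
    permits testing it on all of them. *)
Lemma schouten_vec_vec a b x (ga : dual (A x)) : smooth_vec a -> smooth_vec b ->
  S (vec_mv a) (vec_mv b) x [:: ga] = ga (bracket G a b x).
Proof.
move=> sa sb; have [al sal <-] := cov_extend ga.
have sbm := smooth_vec_mv sb.
have [sS Sb] := schouten_vec SP sa sbm.
have sform be : smooth_cov be -> smooth_form 1 (fun y => covec_form (be y)).
  move=> sbe; split=> [y|e fe [|i [|j s]]]; first exact: alternating_covec_form.
  - exact: smooth_on_cst.
  - exact: sbe.
  - exact: smooth_on_cst.
have E1 : enum 'I_1 = [:: ord0] by rewrite enum_ordSl enum_ord0.
have lieform : is_lie_form G 1 a (fun y => covec_form (al y))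
    (fun y => covec_form (lie_cov G a al y)).
  split; first by apply: sform; exact: smooth_lie_cov.
  move=> c sc y; rewrite E1 big_ord1 /= ?eqxx /lie_fun.
  by rewrite lie_covE.
have := Sb _ _ (sform _ sal) lieform x; rewrite /lie_fun.
have -> : (fun y => pairing (vec_mv b y) (covec_form (al y))) =
    (fun y => al y (b y) : R).
  by apply/funext => y; rewrite pairing1//; exact: (sbm.1 y).
rewrite !pairing1; first last.
- exact: (sS.1 x).
- exact: (sbm.1 x).
move=> ->; rewrite /= lie_covE//; ring.
Qed.

End Schouten.

Section Formulas.
Variables (R : realType) (n : nat) (M : manifold R n) (r : nat).
Variables (A : vector_bundle M r) (G : skew_algebroid A).
Variable (S : mvfield A -> mvfield A -> mvfield A).
Arguments S : clear implicits.
Hypothesis SP : is_schouten G S.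
Implicit Types (a b c : vfield A) (al be ga : covfield A) (P Q : mvfield A).
Implicit Types (f g phi chi : M -> R).

Lemma bracket_comb_r a f b g c x : smooth_vec a -> smooth f -> smooth_vec b ->
  smooth g -> smooth_vec c ->
  bracket G a (fun y => f y *: b y + g y *: c y) x =
    f x *: bracket G a b x + anchor G (a x) f *: b x +
    (g x *: bracket G a c x + anchor G (a x) g *: c x).
Proof.
move=> sa sf sb sg sc; have s1 := smooth_vecZ sf sb; have s2 := smooth_vecZ sg sc.
by rewrite bracketDr// !bracketZr.
Qed.

Lemma bracket_comb_l a f b g c x : smooth_vec a -> smooth f -> smooth_vec b ->
  smooth g -> smooth_vec c ->
  bracket G (fun y => f y *: b y + g y *: c y) a x =
    f x *: bracket G b a x - anchor G (a x) f *: b x +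
    (g x *: bracket G c a x - anchor G (a x) g *: c x).
Proof.
move=> sa sf sb sg sc; have s1 := smooth_vecZ sf sb; have s2 := smooth_vecZ sg sc.
by rewrite bracketDl// !bracketZl.
Qed.

Lemma anchor_mv2C P al be x (v : A x) : smooth_mv 2 P -> smooth_cov al ->
  smooth_cov be -> anchor G v (fun y => P y [:: al y; be y]) =
                   - anchor G v (fun y => P y [:: be y; al y]).
Proof.
move=> sP sa sb; rewrite -anchorNf; last exact: smooth_mv2.
by congr anchor; apply/funext => y; rewrite (alt2C (sP.1 y)).
Qed.

(** This is the familiar
    rho(a) P(al, be) - P(L_a al, be) - P(al, L_a be)
    with the Lie derivatives of al and be expanded on #P be and #P al, which turns
    the sign of the first term. Both sides are linear and local in P. *)
Lemma lie_bivectorE a P al be x : smooth_vec a -> smooth_mv 2 P ->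
  smooth_cov al -> smooth_cov be ->
  S (vec_mv a) P x [:: al x; be x] =
    - anchor G (a x) (fun y => P y [:: al y; be y])
    + be x (bracket G a (sharp P al) x) - al x (bracket G a (sharp P be) x).
Proof.
move=> sa sP0 sal sbe; apply/eqP; rewrite -subr_eq0; apply/eqP.
have sam := smooth_vec_mv sa.
move: P sP0; apply: (bivector_ind (x := x)) => [k P Q sP sQ|phi chi P sphi schi sP chi1 pc|b c sb sc].
- have sPl := smooth_mv2 sP sal sbe; have sQl := smooth_mv2 sQ sal sbe.
  have p1 := smooth_sharp sP sal; have p2 := smooth_sharp sP sbe.
  have q1 := smooth_sharp sQ sal; have q2 := smooth_sharp sQ sbe.
  rewrite (schouten_mv_lin SP k _ sam sP sQ) !sharp_lin// !bracket_linearr//.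
  have -> : anchor G (a x) (fun y => mv_lin k P Q y [:: al y; be y]) =
      k * anchor G (a x) (fun y => P y [:: al y; be y]) +
      anchor G (a x) (fun y => Q y [:: al y; be y]).
    by have [h _] := anchor_tangent G (a x); exact: h.
  rewrite !linearD !linearZ /= /GRing.scale/=; ring.
- have sPl := smooth_mv2 sP sal sbe.
  have p1 := smooth_sharp sP sal; have p2 := smooth_sharp sP sbe.
  have a0 := anchor_absorbed G (a x) sphi schi chi1 pc.
  have phi1 : phi x = 1 by have := pc x; rewrite chi1 mulr1.
  rewrite (schouten_local SP _ sam sP sphi schi chi1 pc) !sharp_scale//.
  rewrite !bracketZr// a0 phi1 !scale1r !scale0r !addr0.
  rewrite (@anchorMf _ _ _ _ _ G x _ phi (fun y => P y [:: al y; be y]))//.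
  by rewrite a0 phi1 mul1r mul0r addr0.
- have sbm := smooth_vec_mv sb; have scm := smooth_vec_mv sc.
  have h1 := smooth_pairing sal sb; have h2 := smooth_pairing sal sc.
  have h3 := smooth_pairing sbe sb; have h4 := smooth_pairing sbe sc.
  rewrite (schouten_wedge SP sam sbm scm) muln1 expr2 mulrNN !mul1r.
  have d1 u : smooth_vec u -> forall t, size t <> 1%N -> S (vec_mv a) (vec_mv u) x t = 0.
    by move=> su t; exact: (degree_mv (schouten_smooth SP sam (smooth_vec_mv su))).
  rewrite !wedge11; try (by move=> t; exact: vec_mv_degree); try exact: d1.
  rewrite !(schouten_vec_vec SP)// !sharp_wedge// !bracket_comb_r//; try exact: smoothN.
  have -> : (fun y => wedge_vec b c y [:: al y; be y]) =
      (fun y => al y (b y) * be y (c y) - be y (b y) * al y (c y)).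
    by apply/funext => y; rewrite wedge_vecE.
  rewrite (@anchorBf _ _ _ _ _ G x (a x) (fun y => al y (b y) * be y (c y))
    (fun y => be y (b y) * al y (c y))); try exact: smoothM.
  rewrite (@anchorMf _ _ _ _ _ G x (a x) (fun y => al y (b y)) (fun y => be y (c y)))//.
  rewrite (@anchorMf _ _ _ _ _ G x (a x) (fun y => be y (b y)) (fun y => al y (c y)))//.
  rewrite !(@anchorNf _ _ _ _ _ G x)//.
  rewrite !linearD !linearZ /= /GRing.scale/=; ring.
Qed.

Lemma koszul2E P xi la al be b x : smooth_mv 2 P -> smooth_vec xi ->
  smooth_cov al -> smooth_cov be -> smooth_vec b ->
  koszul2 G P xi la al be x (b x) =
    koszul G P al be x (b x)
    + al x (xi x) * (anchor G (xi x) (fun y => be y (b y))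
                     - be x (bracket G xi b x) - be x (b x))
    - be x (xi x) * (anchor G (xi x) (fun y => al y (b y))
                     - al x (bracket G xi b x) - al x (b x))
    - P x [:: al x; be x] * la x (b x).
Proof.
move=> sP sxi sal sbe sb; rewrite /koszul2 -!lie_covE//.
set K := koszul _ _ _ _ _; set k := lie_cov _ _ _ _; set k' := lie_cov _ _ _ _.
by rewrite !(add_lfunE, opp_lfunE, scale_lfunE).
Qed.

(** One cyclic term of the polarisation of
    2 (rho(#al) Pi(be, ga) - al([#be, #ga])). *)
Definition cross P Q al be ga (x : M) : R :=
  anchor G (sharp P al x) (fun y => Q y [:: be y; ga y])
  + anchor G (sharp Q al x) (fun y => P y [:: be y; ga y])
  - al x (bracket G (sharp P be) (sharp Q ga) x)
  - al x (bracket G (sharp Q be) (sharp P ga) x).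

(** For Q = b /\ c the product rule gives L_b P /\ c - b /\ L_c P, since
    [P, b] = L_b P. On the other side #Q al = al(b) c - al(c) b, and the terms in
    which the coefficients are differentiated cancel in the cyclic sum. *)
Lemma schouten_bivectorE P Q al be ga x : smooth_mv 2 P -> smooth_mv 2 Q ->
  smooth_cov al -> smooth_cov be -> smooth_cov ga ->
  S P Q x [:: al x; be x; ga x] =
    cross P Q al be ga x + cross P Q be ga al x + cross P Q ga al be x.
Proof.
move=> sP sQ0 sal sbe sga; apply/eqP; rewrite -subr_eq0; apply/eqP.
have sh al' : smooth_cov al' -> smooth_vec (sharp P al') by exact: smooth_sharp.
move: Q sQ0; apply: (bivector_ind (x := x)) => [k Q T sQ sT|phi chi Q sphi schi sQ chi1 pc|b c sb sc].
- rewrite (schouten_mv_lin SP k _ sP sQ sT).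
  have E u v w : smooth_cov u -> smooth_cov v -> smooth_cov w ->
      cross P (mv_lin k Q T) u v w x = k * cross P Q u v w x + cross P T u v w x.
    move=> su sv sw; rewrite /cross !sharp_lin//.
    have t1 := smooth_mv2 sP sv sw; have t2 := smooth_mv2 sQ sv sw.
    have t3 := smooth_mv2 sT sv sw.
    have q1 := smooth_sharp sQ sv; have q2 := smooth_sharp sQ sw.
    have q3 := smooth_sharp sT sv; have q4 := smooth_sharp sT sw.
    rewrite bracket_linearr//; try exact: sh.
    rewrite bracket_linearl//; try exact: sh.
    have -> : anchor G (sharp P u x) (fun y => mv_lin k Q T y [:: v y; w y]) =
      k * anchor G (sharp P u x) (fun y => Q y [:: v y; w y]) +
      anchor G (sharp P u x) (fun y => T y [:: v y; w y]).
      by have [h _] := anchor_tangent G (sharp P u x); exact: h.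
    rewrite anchor_linear// !linearD !linearZ /= /GRing.scale/=; ring.
  rewrite !E//; ring.
- have phi1 : phi x = 1 by have := pc x; rewrite chi1 mulr1.
  have a0 v := @anchor_absorbed _ _ _ _ _ G x v _ _ sphi schi chi1 pc.
  rewrite (schouten_local SP _ sP sQ sphi schi chi1 pc).
  have E u v w : smooth_cov u -> smooth_cov v -> smooth_cov w ->
      cross P (mv_scale phi Q) u v w x = cross P Q u v w x.
    move=> su sv sw; rewrite /cross !sharp_scale//.
    have t1 := smooth_mv2 sP sv sw; have t2 := smooth_mv2 sQ sv sw.
    have q1 := smooth_sharp sQ sv; have q2 := smooth_sharp sQ sw.
    rewrite bracketZr//; try exact: sh.
    rewrite bracketZl//; try exact: sh.
    rewrite !a0 phi1 !scale1r !scale0r subr0 addr0; congr (_ + _ - _ - _).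
    rewrite (@anchorMf _ _ _ _ _ G x _ phi (fun y => Q y [:: v y; w y]))//.
    by rewrite a0 phi1 mul1r mul0r addr0.
  by rewrite !E.
- have sbm := smooth_vec_mv sb; have scm := smooth_vec_mv sc.
  rewrite (schouten_wedge SP sP sbm scm).
  have d2 u : smooth_vec u -> forall t, size t <> 2%N -> S P (vec_mv u) x t = 0.
    by move=> su t; exact: (degree_mv (schouten_smooth SP sP (smooth_vec_mv su))).
  rewrite wedge21; try (by move=> t; exact: vec_mv_degree); try exact: d2.
  rewrite wedge12; try (by move=> t; exact: vec_mv_degree); try exact: d2.
  have L a u v : smooth_vec a -> smooth_cov u -> smooth_cov v ->
      S P (vec_mv a) x [:: u x; v x] =
      - anchor G (a x) (fun y => P y [:: u y; v y])
      + v x (bracket G a (sharp P u) x) - u x (bracket G a (sharp P v) x).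
    move=> sa su sv; rewrite (schouten_sym SP sP (smooth_vec_mv sa)).
    by rewrite muln1 expr2 mulrNN !mul1r lie_bivectorE.
  rewrite !L//.
  have E u v w : smooth_cov u -> smooth_cov v -> smooth_cov w ->
    cross P (wedge_vec b c) u v w x =
      anchor G (sharp P u x) (fun y => v y (b y)) * w x (c x)
      + v x (b x) * anchor G (sharp P u x) (fun y => w y (c y))
      - anchor G (sharp P u x) (fun y => w y (b y)) * v x (c x)
      - w x (b x) * anchor G (sharp P u x) (fun y => v y (c y))
      + u x (b x) * anchor G (c x) (fun y => P y [:: v y; w y])
      - u x (c x) * anchor G (b x) (fun y => P y [:: v y; w y])
      + w x (b x) * u x (bracket G c (sharp P v) x)
      - anchor G (sharp P v x) (fun y => w y (b y)) * u x (c x)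
      - w x (c x) * u x (bracket G b (sharp P v) x)
      + anchor G (sharp P v x) (fun y => w y (c y)) * u x (b x)
      - v x (b x) * u x (bracket G c (sharp P w) x)
      + anchor G (sharp P w x) (fun y => v y (b y)) * u x (c x)
      + v x (c x) * u x (bracket G b (sharp P w) x)
      - anchor G (sharp P w x) (fun y => v y (c y)) * u x (b x).
    move=> su sv sw; rewrite /cross !sharp_wedge//.
    have t1 := smooth_mv2 sP sv sw.
    have h1 := smooth_pairing sv sb; have h2 := smooth_pairing sv sc.
    have h3 := smooth_pairing sw sb; have h4 := smooth_pairing sw sc.
    have n2 := smoothN h2; have n4 := smoothN h4.
    rewrite (bracket_comb_r _ (sh _ sv) h3 sc n4 sb).
    rewrite (bracket_comb_l _ (sh _ sw) h1 sc n2 sb).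
    have -> : (fun y => wedge_vec b c y [:: v y; w y]) =
        (fun y => v y (b y) * w y (c y) - w y (b y) * v y (c y)).
      by apply/funext => y; rewrite wedge_vecE.
    rewrite (@anchorBf _ _ _ _ _ G x _ (fun y => v y (b y) * w y (c y))
      (fun y => w y (b y) * v y (c y))); try exact: smoothM.
    rewrite (@anchorMf _ _ _ _ _ G x _ (fun y => v y (b y)) (fun y => w y (c y)))//.
    rewrite (@anchorMf _ _ _ _ _ G x _ (fun y => w y (b y)) (fun y => v y (c y)))//.
    rewrite !(@anchorNf _ _ _ _ _ G x)// anchorD// !anchorZ//.
    rewrite (bracketC G x (sh _ sv) sc) (bracketC G x (sh _ sv) sb).
    rewrite !linearD !linearN !linearZ /= !linearN /= /GRing.scale/=; ring.
  rewrite !E//=.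
  rewrite !(@anchor_mv2C P ga al x _ sP sga sal).
  rewrite ?expr1 ?expr2; ring.
Qed.

End Formulas.

(** * The structure map of a Jacobi structure *)
Theorem theorem3p1 (R : realType) (n : nat) (M : manifold R n) (r : nat)
    (A : vector_bundle M r) (G : skew_algebroid A)
    (schouten : mvfield A -> mvfield A -> mvfield A)
    (schoutenP : is_schouten G schouten)
    (Pi : mvfield A) (xi : vfield A)
    (jacobi : jacobi_structure schouten Pi xi)
    (la : covfield A) (smooth_la : smooth_cov la)
    (al be : covfield A) (smooth_al : smooth_cov al)
    (smooth_be : smooth_cov be) (x : M) :
  sharp2 Pi xi (koszul2 G Pi xi la al be) x
    - bracket G (sharp2 Pi xi al) (sharp2 Pi xi be) x
  = Pi x [:: al x; be x] *: (xi x - sharp2 Pi xi la x).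
Proof.
have [sP sxi PiPi xiPi] := jacobi; have aP := sP.1 x.
apply: vec_eq_cov => ga sga.
have sha := smooth_sharp sP smooth_al.
have shb := smooth_sharp sP smooth_be.
have shg := smooth_sharp sP sga.
have sa := smooth_pairing smooth_al sxi.
have sb := smooth_pairing smooth_be sxi.
have sg := smooth_pairing sga sxi.
(* L_xi Pi = 0, solved for one of the two brackets *)
have inv u v : smooth_cov u -> smooth_cov v ->
    v x (bracket G xi (sharp Pi u) x) =
    anchor G (xi x) (fun y => Pi y [:: u y; v y]) + u x (bracket G xi (sharp Pi v) x).
  move=> su sv; have := lie_bivectorE schoutenP x sxi sP su sv.
  by rewrite xiPi => h; lra.
have self : cross G Pi Pi al be ga x + cross G Pi Pi be ga al x +
    cross G Pi Pi ga al be x = 2 * wedge (vec_mv xi x) (Pi x) [:: al x; be x; ga x].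
  by rewrite -PiPi (schouten_bivectorE schoutenP).
move: self; rewrite /cross wedge12; last first.
- by move=> t; exact: (degree_mv sP).
- by move=> t; exact: vec_mv_degree.
rewrite (bracketC G x shg sha) !linearN /= => self.
(* evaluating ga on #k is evaluating k on - #ga, so that the Koszul bracket is
   only needed on the sections #ga and xi *)
have tx (k : covfield A) : ga x (sharp2 Pi xi k x) =
    - k x (sharp Pi ga x) + k x (xi x) * ga x (xi x).
  by rewrite /sharp2 linearD linearZ /= !(sharpE _ sP) (alt2C aP (k x)) opprK.
rewrite linearB linearZ /= linearB /= !tx !koszul2E// !koszulE//.
have sfun (u v : covfield A) : (fun y => u y (sharp Pi v y) : R) = (fun y => Pi y [:: v y; u y]).
  by apply/funext => y; rewrite (sharpE _ sP).
rewrite !sfun !(sharpE _ sP).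
have s2b := smooth_vecZ sb sxi; have s2a := smooth_vecZ sa sxi.
rewrite /sharp2.
rewrite bracketDr//; last exact: smooth_vecD.
rewrite !bracketDl// !bracketZr// !bracketZl// !(bracket_self _ _ sxi).
rewrite (bracketC G x sha sxi) (bracketC G x shb sxi).
rewrite !scaler0 !(linear0 (al x)) !(linear0 (be x)) !(linearN (al x)) !(linearN (be x)).
rewrite !(linearD (ga x), linearN (ga x), linearZ_LR (ga x), linear0 (ga x)).
rewrite /= /GRing.scale/= anchorZ//.
rewrite (inv al ga)// (inv be ga)// (inv al be)//.
rewrite (anchor_mv2C G _ sP sga smooth_be) (anchor_mv2C G (xi x) sP sga smooth_al).
rewrite (anchor_mv2C G (xi x) sP sga smooth_be).
rewrite (alt2C aP (be x) (ga x)) (alt2C aP (al x) (ga x)).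
(* [Pi, Pi] = 2 xi /\ Pi, solved for the bracket of the two sharps *)
have -> : ga x (bracket G (sharp Pi al) (sharp Pi be) x) =
    anchor G (sharp Pi al x) (fun y => Pi y [:: be y; ga y]) -
    al x (bracket G (sharp Pi be) (sharp Pi ga) x) +
    anchor G (sharp Pi be x) (fun y => Pi y [:: ga y; al y]) +
    be x (bracket G (sharp Pi al) (sharp Pi ga) x) +
    anchor G (sharp Pi ga x) (fun y => Pi y [:: al y; be y]) -
    (al x (xi x) * Pi x [:: be x; ga x] - be x (xi x) * Pi x [:: al x; ga x] +
     ga x (xi x) * Pi x [:: al x; be x]) by lra.
ring.
Qed.
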